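(* Let $\dim(\mathcal{H})<\infty$, let $\tau$ be the usual trace on $\mathcal{M}=\mathcal{B}(\mathcal{H})$, and let $H_0=H_0^*,V=V^*\in\mathcal{M}$. Let $p\in\mathbf{N}$. Then the density of the measure $\nu_p$ satisfying $$\tau[R_{p,H_0,V}(f)]=\int_{\mathbf{R}}f^{(p)}(t)\,d\nu_p(t)$$ equals $$\eta_p(t)=\frac{1}{(p-1)!}\int_{\mathbf{R}^{p+1}\setminus D_{p+1}}\Delta^{(p)}_{\lambda_1,\dots,\lambda_{p+1}}\big((\lambda-t)_+^{p-1}\big)\,dm^{(2)}_{p,H_0,V}(\lambda_1,\lambda_2,\dots,\lambda_{p+1})$$ for a.e. $t\in\mathbf{R}$.
   Context: Remainder: $R_{p,H_0,V}(f)=f(H_0+V)-\sum_{j=0}^{p-1}\frac{1}{j!}\frac{d^j}{dt^j}\big|_{t=0}f(H_0+tV)$. The measure $\nu_p$ is the finite, compactly supported real-valued measure (known to exist) for which the displayed trace formula holds for all rational functions $f$ on $\mathbf{R}$ with nonreal poles (including polynomials). $D_{p+1}=\{(\lambda_1,\dots,\lambda_{p+1}):\lambda_1=\cdots=\lambda_{p+1}\in\mathbf{R}\}$. $E_H$ is the spectral measure of $H$, and $m^{(2)}_{p,H_0,V}$ is the Borel measure on $\mathbf{R}^{p+1}$ with $m^{(2)}_{p,H_0,V}(A_1\times\cdots\times A_{p+1})=\tau[E_{H_0+V}(A_1)VE_{H_0}(A_2)V\cdots VE_{H_0}(A_p)VE_{H_0}(A_{p+1})]$. Divided differences (with respect to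 the real variable $\lambda$): $\Delta^{(0)}_{\lambda_1}(f)=f(\lambda_1)$, and $\Delta^{(p)}_{\lambda_1,\dots,\lambda_{p+1}}(f)$ equals $\frac{\Delta^{(p-1)}_{\lambda_1,\dots,\lambda_{p-1},\lambda_p}(f)-\Delta^{(p-1)}_{\lambda_1,\dots,\lambda_{p-1},\lambda_{p+1}}(f)}{\lambda_p-\lambda_{p+1}}$ if $\lambda_p\ne\lambda_{p+1}$ and $\frac{\partial}{\partial t}\big|_{t=\lambda_p}\Delta^{(p-1)}_{\lambda_1,\dots,\lambda_{p-1},t}(f)$ if $\lambda_p=\lambda_{p+1}$. Truncated power: $x_+^k=x^k$ if $x\ge0$, $x_+^k=0$ if $x<0$. For $p=1$ the basic spline $t\mapsto\Delta^{(1)}_{\lambda_1,\lambda_2}((\lambda-t)_+^0)$ is $\frac{1}{|\lambda_2-\lambda_1|}\chi_{(\min\{\lambda_1,\lambda_2\},\max\{\lambda_1,\lambda_2\})}(t)$. *)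

(* Defs.v *)
From HB Require Import structures.
From mathcomp Require Import all_boot all_order all_algebra.
From mathcomp Require Import complex.
From mathcomp Require Import all_classical all_reals all_analysis.

Set Implicit Arguments.
Unset Strict Implicit.
Unset Printing Implicit Defensive.

Import Order.TTheory GRing.Theory Num.Theory.
Import numFieldNormedType.Exports.

Local Open Scope classical_set_scope.
Local Open Scope ring_scope.
Local Open Scope complex_scope.

(* B(H) for dim H = n is represented by the matrices 'M[R[i]]_n with their
   usual trace \tr; they act on row vectors, so H = U^-1 *m diag *m U with
   U = spectralmx H unitary when H is hermitian. *)

Section SpectralCalculus.
Variables (R : realType) (n : nat).
Implicit Types (H V : 'M[R[i]]_n) (f : R -> R[i]).

(* f(H); meaningful for hermitian H, whose spectral_diag has real entries. *)
Definition mxcalc f H : 'M[R[i]]_n :=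
  invmx (spectralmx H)
    *m diag_mx (\row_(k < n) f (complex.Re (spectral_diag H 0 k)))
    *m spectralmx H.

Definition spectral_measure H (A : set R) : 'M[R[i]]_n :=
  mxcalc (fun x => (\1_A x)%:C) H.

(* Iterated derivatives of complex- and matrix-valued functions of a real
   variable are taken componentwise. *)
Definition cderiven (k : nat) f : R -> R[i] := fun t =>
  Complex (derive1n k (fun s => complex.Re (f s)) t)
          (derive1n k (fun s => complex.Im (f s)) t).

Definition mxderiven (k : nat) (F : R -> 'M[R[i]]_n) (t : R) : 'M[R[i]]_n :=
  \matrix_(a, b) cderiven k (fun s => F s a b) t.

Definition remainder (p : nat) H V f : 'M[R[i]]_n :=
  mxcalc f (H + V) -
  \sum_(j < p) ((j`!)%:R^-1 : R[i]) *:
     mxderiven j (fun t : R => mxcalc f (H + t%:C *: V)) 0.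

End SpectralCalculus.

Definition rational_nonreal_poles (R : realType) (f : R -> R[i]) : Prop :=
  exists P Q : {poly R[i]},
    (forall x : R, Q.[x%:C] != 0) /\ (forall x : R, f x = P.[x%:C] / Q.[x%:C]).

Section ChargeIntegral.
Context d (T : measurableType d) (R : realType).
Implicit Types (nu : {charge set T -> \bar R}) (D : set T).

Let hahn nu := proj2_sig (cid (proj2_sig (cid (Hahn_decomposition nu)))).

(* Jordan parts are independent of the Hahn decomposition chosen here. *)
Definition charge_integral nu D (g : T -> R) : R :=
  Rintegral (jordan_pos (hahn nu)) D g - Rintegral (jordan_neg (hahn nu)) D g.

Definition charge_cintegral nu D (g : T -> R[i]) : R[i] :=
  Complex (charge_integral nu D (fun x => complex.Re (g x)))
          (charge_integral nu D (fun x => complex.Im (g x))).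

Record complex_measure := ComplexMeasure {
  cmRe : {charge set T -> \bar R};
  cmIm : {charge set T -> \bar R} }.

Definition cmeasure (m : complex_measure) (A : set T) : R[i] :=
  Complex (fine (cmRe m A)) (fine (cmIm m A)).

Definition cmeasure_integral (m : complex_measure) D (g : T -> R) : R[i] :=
  Complex (charge_integral (cmRe m) D g) (charge_integral (cmIm m) D g).

End ChargeIntegral.

Arguments complex_measure {d} T R.

Section Measures.
Variable R : realType.
Local Notation RT := (measurableTypeR R).

Definition compactly_supported (nu : {charge set RT -> \bar R}) : Prop :=
  exists K : set R, compact K /\
    forall A : set RT, measurable A -> A `&` K = set0 -> nu A = 0%E.

Definition trace_formula_measure (n p : nat) (H0 V : 'M[R[i]]_n)
    (nu : {charge set RT -> \bar R}) : Prop :=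
  compactly_supported nu /\
  forall f : R -> R[i], rational_nonreal_poles f ->
    \tr (remainder p H0 V f) = charge_cintegral nu setT (cderiven p f).

(* The tuple sigma-algebra is the one generated by the coordinates, i.e. the
   Borel sigma-algebra of R^(p+1). *)
Definition is_m2 (n p : nat) (H0 V : 'M[R[i]]_n)
    (m : complex_measure (p.+1.-tuple RT) R) : Prop :=
  forall A : 'I_p.+1 -> set RT, (forall i, measurable (A i)) ->
    cmeasure m [set x | forall i, A i (tnth x i)] =
    \tr (spectral_measure (H0 + V) (A ord0) *m
         \big[mulmx/1%:M]_(i < p)
            (V *m spectral_measure H0 (A (lift ord0 i)))).

Definition diagonal (k : nat) : set (k.-tuple RT) :=
  [set x | forall i j, tnth x i = tnth x j].

End Measures.

Section DividedDifference.
Variable R : realType.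

Definition truncpow (k : nat) (x : R) : R := if 0 <= x then x ^+ k else 0.

(* divdiff_rev f [:: lambda_p; ...; lambda_1] lambda_(p+1) is the divided
   difference of f at lambda_1, ..., lambda_(p+1). *)
Fixpoint divdiff_rev (f : R -> R) (s : seq R) (x : R) : R :=
  if s is y :: s' then
    if y == x then derive1 (divdiff_rev f s') y
    else (divdiff_rev f s' y - divdiff_rev f s' x) / (y - x)
  else f x.

(* When a derivative in the recursion fails to exist (truncated powers at
   their knot t), derive1 is an arbitrary value; for given nodes this concerns
   only finitely many t. *)
Definition divdiff (p : nat) (lam : p.+1.-tuple R) (f : R -> R) : R :=
  divdiff_rev f (rev (belast (thead lam) (behead lam)))
    (last (thead lam) (behead lam)).

End DividedDifference.

(* Complex a priori, like the measure m. *)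
Definition eta (R : realType) (p : nat)
    (m : complex_measure (p.+1.-tuple (measurableTypeR R)) R) (t : R) : R[i] :=
  ((p.-1)`!)%:R^-1 *
  cmeasure_integral m (~` @diagonal R p.+1)
    (fun lam => divdiff lam (fun x => truncpow p.-1 (x - t))).

(* Main.v *)
Require Import Defs.
From mathcomp Require Import all_boot all_order all_algebra.
From mathcomp Require Import ring lra.
From mathcomp Require Import complex.
From mathcomp Require Import all_classical all_reals all_analysis.
From mathcomp Require Import measurable_realfun.

Set Implicit Arguments.
Unset Strict Implicit.
Unset Printing Implicit Defensive.

Import Order.TTheory GRing.Theory Num.Theory.
Import numFieldNormedType.Exports.

Local Open Scope classical_set_scope.
Local Open Scope ring_scope.
Local Open Scope complex_scope.
Local Open Scope charge_scope.

(** Both sides of the trace formula are finite sums over words of eigenvalues,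
and the theorem is the comparison of these sums.

The Taylor tail [T p N] of [(H0 + t V)^N] at [t = 1], that is [(H0 + V)^N] minus
its first [p] Taylor terms, satisfies
[T (p+1) (N+1) = T (p+1) N * H0 + T p N * V].  The divided difference of [X^N]
obeys the same recursion when a node is appended, by the Leibniz rule for the
factor [X].  Inserting spectral projections therefore gives
[tr (R_p (X^N)) = sum_w m2 {w} * (divided difference of X^N at w)]
([taylor_tail_words]).  A word with all letters equal to [z] has no mass:
[E_{H0+V}(z) V E_{H0}(z)] is [z - z] times [E_{H0+V}(z) E_{H0}(z)]
([mxword_diag]).

For a word [w] with at least two distinct letters, Peano's theorem writes the
divided difference of [f] at [w] as the integral of [f^(p) / (p-1)!] against the
divided difference of the truncated power [(x - t)_+^(p-1)] at [w].  Repeated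
nodes call for derivatives of truncated powers.  They are avoided as follows:
a divided difference at nodes in a finite set [S] only depends on the function
up to an error which is small to high order at each point of [S]
([divdiff_rev_eq]), and up to such an error the truncated power is the
polynomial [sum_(z > t) (X - t)^(p-1) * e_z], where the [e_z] are the idempotents
of the Chinese remainder theorem for the moduli [(X - z)^m].  The kernel thus
becomes piecewise polynomial in [t] ([divdiff_truncpow]); its primitives are
explicit, being built from Taylor polynomials of [f], and Peano's theorem turns
into a statement on polynomials ([peano_identity]).

Consequently [eta_p dt] and [nu_p] have the same moments.  Both have compact
support, so they agree ([charge_of_moments]): explicit polynomials converge
boundedly to the indicator of a half-line, and half-lines form a generating
pi-system.  The measure [m2] is given on boxes only; as boxes form a generating
pi-system too, it is concentrated on the finite set of words
([nodes_concentrated]), and [eta_p] is the finite sum above.  Finally [eta_p] is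
complex a priori: the moments show that both [Re eta_p] and [Re eta_p + Im eta_p]
are densities of [nu_p], hence the imaginary part vanishes almost everywhere. *)

(** * Divided differences of polynomials *)

Section PolynomialDividedDifferences.
Variable F : fieldType.
Implicit Types (f g q e : {poly F}) (p : nat) (s w N : seq F).

Definition quotient_at q (y : F) : {poly F} := (q - q.[y]%:P) %/ ('X - y%:P).

(** The successive quotients of Newton's interpolation formula: with nodes
[y_1, ..., y_j] (last one first in the list), this is the polynomial in [x] whose
value is the divided difference at [y_1, ..., y_j, x], also when [x] is one of
the nodes. *)
Fixpoint newton q s : {poly F} :=
  if s is y :: s' then quotient_at (newton q s') y else q.

Definition ddiff q w : F := if w is z :: s then (newton q s).[z] else 0.

Definition nodal w : {poly F} := \prod_(y <- w) ('X - y%:P).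

Lemma quotient_atP q y : q = quotient_at q y * ('X - y%:P) + q.[y]%:P.
Proof.
rewrite /quotient_at divpK ?subrK // dvdp_XsubCl /root !hornerE subrr //.
Qed.

Lemma quotient_at_uniq q r y c : q = r * ('X - y%:P) + c%:P -> quotient_at q y = r.
Proof.
move=> ->; rewrite /quotient_at !hornerE subrr mulr0 add0r addrK.
by rewrite mulpK // polyXsubC_eq0.
Qed.

Lemma quotient_at_linear a g q y :
  quotient_at (a *: g + q) y = a *: quotient_at g y + quotient_at q y.
Proof.
apply: (@quotient_at_uniq _ _ _ (a * g.[y] + q.[y])).
rewrite {1}(quotient_atP g y) {1}(quotient_atP q y).
by rewrite polyCD polyCM -!mul_polyC; ring.
Qed.

Lemma newton_linear a g q s : newton (a *: g + q) s = a *: newton g s + newton q s.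
Proof. by elim: s => //= y s ->; rewrite quotient_at_linear. Qed.

Lemma ddiff_linear a g q w : ddiff (a *: g + q) w = a * ddiff g w + ddiff q w.
Proof.
by case: w => [|z s] /=; rewrite ?mulr0 ?addr0 // newton_linear !hornerE.
Qed.

Lemma ddiff0 w : ddiff 0 w = 0.
Proof. by have := ddiff_linear (-1) 0 0 w; rewrite scaler0 addr0 mulN1r addNr. Qed.

Lemma ddiffD g q w : ddiff (g + q) w = ddiff g w + ddiff q w.
Proof. by rewrite -[g]scale1r ddiff_linear mul1r scale1r. Qed.

Lemma ddiffZ a g w : ddiff (a *: g) w = a * ddiff g w.
Proof. by rewrite -[a *: g]addr0 ddiff_linear ddiff0 addr0. Qed.

Lemma ddiff_sum (I : Type) (r : seq I) (f : I -> {poly F}) w :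
  ddiff (\sum_(i <- r) f i) w = \sum_(i <- r) ddiff (f i) w.
Proof. by apply: (big_morph (ddiff^~ w)) => [g q|]; rewrite ?ddiffD ?ddiff0. Qed.

(** Leibniz rule: the divided differences of ['X] of order two and more vanish,
so only two terms remain. *)
Lemma newtonX q s : newton ('X * q) s = 'X * newton q s + (ddiff q s)%:P.
Proof.
elim: s => [|y s IH] /=; first by rewrite addr0.
rewrite IH; apply: (@quotient_at_uniq _ _ _ (y * (newton q s).[y] + ddiff q s)).
rewrite {1}(quotient_atP (newton q s) y) polyCD polyCM; ring.
Qed.

Lemma ddiffX q z s : ddiff ('X * q) (z :: s) = z * ddiff q (z :: s) + ddiff q s.
Proof. by rewrite /= newtonX !hornerE. Qed.

Lemma newton_small q s : (size q <= size s)%N -> newton q s = 0.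
Proof.
have aux (r : {poly F}) y n : (size r <= n.+1)%N -> (size (quotient_at r y) <= n)%N.
  move=> rn; rewrite /quotient_at size_divp ?polyXsubC_eq0 // size_XsubC.
  rewrite leq_subLR add1n (leq_trans (size_polyD _ _)) // size_polyN geq_max rn.
  by rewrite (leq_trans (size_polyC_leq1 _)).
have aux2 m : (size q <= m + size s)%N -> (size (newton q s) <= m)%N.
  elim: s m => [|y s IH] m /=; first by rewrite addn0.
  by rewrite addnS -addSn => /IH; exact: aux.
by move=> qs; apply/eqP; rewrite -size_poly_leq0; apply: aux2.
Qed.

Lemma ddiff_small q z s : (size q <= size s)%N -> ddiff q (z :: s) = 0.
Proof. by move=> qs /=; rewrite newton_small // horner0. Qed.

(** Division by one linear factor per node undoes the product by the nodal
polynomial, since no remainder occurs. *)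
Lemma newton_nodal r s : newton (r * nodal s) s = r.
Proof.
elim: s r => [|y s IH] r /=; first by rewrite /nodal big_nil mulr1.
rewrite /nodal big_cons mulrA IH.
by apply: (@quotient_at_uniq _ _ _ 0); rewrite addr0.
Qed.

Lemma ddiff_dvd q w : nodal w %| q -> ddiff q w = 0.
Proof.
case: w => [|z s] // /dvdpP [r ->] /=.
by rewrite /nodal big_cons mulrA newton_nodal !hornerE subrr mulr0.
Qed.

(** Hermite interpolation: only the jets at the nodes matter, to the order given
by the multiplicities. *)
Lemma ddiff_congr g q w : nodal w %| g - q -> ddiff g w = ddiff q w.
Proof. by move=> /ddiff_dvd pq; rewrite -[g](subrK q) ddiffD pq add0r. Qed.

(** The powers of distinct linear factors are coprime, so the condition can be
checked one node at a time. *)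
Lemma dvdp_nodal N w q : {subset w <= N} ->
  (forall z, z \in N -> ('X - z%:P) ^+ count_mem z w %| q) -> nodal w %| q.
Proof.
move=> wN zq.
suff H s : uniq s -> {subset s <= w} ->
  \prod_(z <- s) ('X - z%:P) ^+ count_mem z w %| q.
  rewrite /nodal -prodr_undup_exp_count; apply: H; first exact: undup_uniq.
  by move=> z; rewrite mem_undup.
elim: s => [|y s IH] /=; first by rewrite big_nil dvd1p.
move=> /andP[ys us] sw; rewrite big_cons Gauss_dvdp.
  rewrite zq ?wN ?sw ?mem_head //= IH // => z zs.
  by rewrite sw // inE zs orbT.
rewrite big_seq; apply: (big_ind (fun r => coprimep _ r)).
- by rewrite coprimep1.
- by move=> a b ca cb; rewrite coprimepMr ca.
move=> z zs; apply: coprimep_expl; apply: coprimep_expr.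
rewrite coprimep_XsubC root_XsubC; apply: contraNneq ys => <- //.
Qed.

(** Chinese remainder theorem for the pairwise coprime moduli [(X - y)^m]. *)
Lemma idempotent_exists m N (z : F) : uniq N -> z \in N -> exists e : {poly F},
  ('X - z%:P) ^+ m %| e - 1 /\
  forall y, y \in N -> y != z -> ('X - y%:P) ^+ m %| e.
Proof.
move=> uN zN.
pose r := \prod_(y <- rem z N) ('X - y%:P) ^+ m.
have /Bezout_eq1_coprimepP [[u v] /= uv] : coprimep (('X - z%:P) ^+ m) r.
  rewrite /r big_seq; apply: (big_ind (fun r => coprimep _ r)).
  - by rewrite coprimep1.
  - by move=> a b ca cb; rewrite coprimepMr ca.
  move=> y; rewrite mem_rem_uniq // inE => /andP[yz yN].
  by apply: coprimep_expl; apply: coprimep_expr; rewrite coprimep_XsubC root_XsubC.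
exists (v * r); split.
  rewrite -uv opprD addrCA subrr addr0 dvdpNr; exact: dvdp_mulIr.
move=> y yN yz; apply: dvdp_mull; rewrite /r (big_rem y) /=.
  exact: dvdp_mulIl.
by rewrite mem_rem_uniq // inE yz.
Qed.

(** As a polynomial in [t], the divided difference of [(X - t)^j * e] at [w]; the
recursion splits off one factor [X - t]. *)
Fixpoint kernel_poly (w : seq F) (j : nat) e : {poly F} :=
  if j is j'.+1 then kernel_poly w j' ('X * e) - 'X * kernel_poly w j' e
  else (ddiff e w)%:P.

Lemma horner_kernel_poly w j e t :
  (kernel_poly w j e).[t] = ddiff (('X - t%:P) ^+ j * e) w.
Proof.
elim: j e => [|j IH] e /=; first by rewrite hornerC expr0 mul1r.
rewrite hornerD hornerN hornerM hornerX !IH exprSr -mulrA mulrBl mulrBr ddiffD; congr (_ + _).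
by rewrite mul_polyC -scalerAr -scaleNr ddiffZ mulNr.
Qed.

Lemma kernel_polyS w j e :
  kernel_poly w j.+1 e = kernel_poly w j ('X * e) - 'X * kernel_poly w j e.
Proof. by []. Qed.

Lemma deriv_kernel_poly w j e :
  (kernel_poly w j.+1 e)^`() = - (kernel_poly w j e *+ j.+1).
Proof.
elim: j e => [|j IH] e.
  rewrite kernel_polyS derivB derivM derivX !derivC mul1r mulr0 addr0 sub0r.
  by rewrite mulr1n.
rewrite kernel_polyS derivB derivM derivX !IH mul1r kernel_polyS.
move: (kernel_poly w j _) (kernel_poly w j _) => A B.
rewrite [in RHS]mulrSr mulrN mulrnAr [in RHS]opprD mulrnBl.
by rewrite -[LHS]opprD -[RHS]opprD addrA addrAC.
Qed.

Definition taylor_poly f p (z : F) : {poly F} :=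
  \sum_(j < p) (f^`N(j)).[z] *: ('X - z%:P) ^+ j.

Lemma taylor_polyE f z n : (size f <= n)%N -> f = taylor_poly f n z.
Proof.
move=> sf; have := @nderiv_taylor_wide {poly F} n (map_poly polyC f) z%:P ('X - z%:P)
  (mulrC _ _).
rewrite (leq_trans (size_poly _ _)) // => /(_ isT).
rewrite addrC subrK -/(f \Po 'X) comp_polyXr => {1}->.
apply: eq_bigr => i _.
by rewrite nderivn_map horner_map mul_polyC.
Qed.

Lemma taylor_poly_dvd f p z : ('X - z%:P) ^+ p %| f - taylor_poly f p z.
Proof.
rewrite {1}(@taylor_polyE f z (p + size f)) ?leq_addl // /taylor_poly.
rewrite big_split_ord /= addrAC subrr add0r.
apply: (big_ind (fun r => _ %| r)); rewrite ?dvdp0 //; first exact: dvdp_add.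
by move=> i _; rewrite exprD -mul_polyC dvdp_mull // dvdp_mulIl.
Qed.

Lemma size_taylor_poly f p z : (size (taylor_poly f p z) <= p)%N.
Proof.
apply: (leq_trans (size_sum _ _ _)); apply/bigmax_leqP => i _.
by rewrite (leq_trans (size_scale_leq _ _)) // size_exp_XsubC.
Qed.

(** Up to a factorial, an antiderivative in [t] of the Peano integrand
[f^(p)(t) * (divided difference of (X - t)^(p-1) * e)]: the sum is the divided
difference of [e] times the Taylor polynomial of [f] at [t], and differentiating
a Taylor polynomial in its base point leaves only the last term. *)
Definition kernel_primitive w p f e : {poly F} :=
  \sum_(j < p) f^`N(j) * kernel_poly w j e.

Lemma horner_kernel_primitive w p f e t :
  (kernel_primitive w p f e).[t] = ddiff (taylor_poly f p t * e) w.
Proof.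
rewrite /kernel_primitive horner_sum mulr_suml ddiff_sum.
by apply: eq_bigr => j _; rewrite hornerM horner_kernel_poly -scalerAl ddiffZ.
Qed.

Lemma deriv_nderivn f j : (f^`N(j))^`() = f^`N(j.+1) *+ j.+1.
Proof.
apply/polyP => i; rewrite coef_deriv coefMn !coef_nderivn -!mulrnA.
rewrite addnS addSn; congr (_ *+ _).
by rewrite mulnC [RHS]mulnC mul_bin_left subSn ?leq_addr // addKn.
Qed.

(** The sum telescopes. *)
Lemma deriv_kernel_primitive w p f e :
  (kernel_primitive w p.+1 f e)^`() = (f^`N(p.+1) *+ p.+1) * kernel_poly w p e.
Proof.
elim: p => [|p IH].
  rewrite /kernel_primitive big_ord1 derivM derivC mulr0 addr0.
  by rewrite deriv_nderivn.
rewrite /kernel_primitive big_ord_recr derivD -/(kernel_primitive w p.+1 f e) IH.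
rewrite derivM deriv_nderivn deriv_kernel_poly mulrN mulrnAr -mulrnAl.
by rewrite addrCA subrr addr0.
Qed.

End PolynomialDividedDifferences.

(** * The Peano kernel as an algebraic identity *)

Section PeanoKernel.
Variable F : fieldType.
Variables (N : seq F) (p m : nat) (idem : F -> {poly F}).
Hypothesis uN : uniq N.
Hypothesis idem1 : forall z, z \in N -> ('X - z%:P) ^+ m %| idem z - 1.
Hypothesis idem0 : forall z y, z \in N -> y \in N -> y != z ->
  ('X - y%:P) ^+ m %| idem z.

Lemma sum_idem z : z \in N -> ('X - z%:P) ^+ m %| \sum_(y <- N) idem y - 1.
Proof.
move=> zN; rewrite (big_rem z) //= -addrA addrCA; apply: dvdp_add; last exact: idem1.
rewrite big_seq; apply: (big_ind (fun r => _ %| r)); rewrite ?dvdp0 //.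
  exact: dvdp_add.
move=> y; rewrite mem_rem_uniq // inE => /andP[yz yN].
by apply: idem0; rewrite // eq_sym.
Qed.

(** The idempotents add up to 1 modulo every [(X - z)^m]. *)
Lemma ddiff_sum_idem (q : {poly F}) w : {subset w <= N} -> (size w <= m)%N ->
  ddiff (q * \sum_(y <- N) idem y) w = ddiff q w.
Proof.
move=> wN wm; apply: ddiff_congr; rewrite -[X in _ - X]mulr1 -mulrBr.
apply: (dvdp_nodal wN) => z zN; apply: dvdp_mull.
apply: dvdp_trans (sum_idem zN); apply: dvdp_exp2l.
exact: leq_trans (count_size _ _) wm.
Qed.

(** Peano's theorem after integration.  At the base point [z], multiplication by
[idem z] makes the Taylor polynomial at [z] as good as [f]; the sum over [z]
reassembles the divided difference of [f].  At the base point [a] the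
idempotents sum up to 1, and the Taylor polynomial is killed, its degree being
less than [p].  Multiplicities at most [p] are what the Taylor polynomials of
order [p] can resolve; this excludes exactly the constant words. *)
Lemma peano_identity (f : {poly F}) w a : {subset w <= N} -> (size w <= m)%N ->
  size w = p.+1 -> (forall z, count_mem z w <= p)%N ->
  \sum_(z <- N) ((kernel_primitive w p f (idem z)).[z]
               - (kernel_primitive w p f (idem z)).[a]) = ddiff f w.
Proof.
move=> wN wm sw cw; rewrite big_split /= sumrN.
under [X in _ - X]eq_bigr do rewrite horner_kernel_primitive.
rewrite -[X in _ - X]ddiff_sum -mulr_sumr ddiff_sum_idem //.
have -> : ddiff (taylor_poly f p a) w = 0.
  by case: w sw {wN wm cw} => // z s [sp]; rewrite ddiff_small // sp size_taylor_poly.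
rewrite subr0 -[RHS](ddiff_sum_idem _ wN wm) mulr_sumr ddiff_sum.
rewrite big_seq [RHS]big_seq; apply: eq_bigr => z zN.
rewrite horner_kernel_primitive; apply/esym/ddiff_congr; rewrite -mulrBl.
apply: (dvdp_nodal wN) => y yN; have [->|yz] := eqVneq y z.
  apply: dvdp_mulr; apply: dvdp_trans (taylor_poly_dvd f p z).
  exact: dvdp_exp2l.
apply: dvdp_mull; apply: dvdp_trans (idem0 zN yN yz).
by apply: dvdp_exp2l; apply: leq_trans (count_size _ _) wm.
Qed.

End PeanoKernel.

(** * Divided differences of functions, by jets *)

Section Jets.
Variable R : realType.
Implicit Types (f h : R -> R) (q : {poly R}) (s N : seq R).

(** [h x = O(|x - z|^k)] near [z], including at [z] itself: for [0 < k] it forces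
[h z = 0]. *)
Definition flat (k : nat) (z : R) h : Prop :=
  exists C : R, \forall x \near z, `|h x| <= C * `|x - z| ^+ k.

Lemma flat_at k z h : flat k.+1 z h -> h z = 0.
Proof.
move=> [C /nbhs_singleton]; rewrite subrr normr0 expr0n mulr0 normr_le0.
by move/eqP.
Qed.

Lemma flat_horner k z q : ('X - z%:P) ^+ k %| q -> flat k z (horner q).
Proof.
move=> /dvdpP [r ->].
have [M [_ rM]] : bounded_near (horner r) (nbhs z).
  by apply: cvg_bounded; exact: continuous_horner.
exists (M + 1); near=> x.
rewrite hornerM horner_exp hornerXsubC normrM normrX ler_wpM2r //.
by near: x; apply: rM; rewrite ltrDl.
Unshelve. all: by end_near. Qed.

Lemma flat_is_derive k z h : flat k.+2 z h -> is_derive z 1 h 0.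
Proof.
move=> fl; have hz := flat_at fl; case: fl => C hC.
have quot0 : (fun t : R => t^-1 *: ((h \o shift z) (t *: (1 : R)) - h z)) @ 0^' --> (0 : R).
  apply/cvgr0Pnorm_le => e e0.
  have shiftz : (fun t : R => t + z) @ 0^' --> z.
    rewrite -[X in _ --> X]add0r; apply: cvgD; last exact: cvg_cst.
    exact: cvg_within.
  have {}hC := shiftz _ hC.
  pose B := Num.max C 1; have B0 : 0 < B by rewrite lt_max ltr01 orbT.
  near=> t.
  have t0 : t != 0 by near: t; exact: nbhs_dnbhs_neq.
  have tB : `|t| <= e / B.
    near: t; apply: cvg_within.
    by apply: (@cvgr0_norm_le _ _ _ (nbhs (0:R)) _ id) => //; rewrite divr_gt0.
  have t1 : `|t| <= 1.
    by near: t; apply: cvg_within; exact: (@cvgr0_norm_le _ _ _ (nbhs (0:R)) _ id).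
  have : `|h (t + z)| <= C * `|t + z - z| ^+ k.+2 by near: t.
  rewrite addrK /= /shift /= hz subr0 [t *: 1]mulr1 normrM normfV => ht.
  rewrite mulrC ler_pdivrMr ?normr_gt0 //; apply: le_trans ht _.
  rewrite (le_trans (_ : _ <= B * `|t| ^+ k.+2)) //.
    by rewrite ler_wpM2r // ?exprn_ge0 // le_max lexx.
  rewrite exprS mulrCA mulrC ler_wpM2r // -ler_pdivlMl // mulrC.
  by rewrite (le_trans _ tB) // exprS ler_piMr // exprn_ile1.
apply: DeriveDef; first by apply/cvg_ex; exists 0.
exact/cvg_lim.
Unshelve. all: by end_near. Qed.

Lemma divdiff_rev_horner q s x : divdiff_rev (horner q) s x = (newton q s).[x].
Proof.
elim: s x => [|y s IH] x //=.
have -> : divdiff_rev (horner q) s = horner (newton q s) by apply/funext.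
have qE := quotient_atP (newton q s) y.
case: eqVneq => [<-|yx].
  rewrite -derivE {1}qE derivD derivM derivXsubC derivC !hornerE subrr mulr0.
  by rewrite add0r.
rewrite {2}qE !hornerE opprD addrCA subrr addr0 -mulrN opprB mulfK //.
by rewrite subr_eq0.
Qed.

(** Each node costs one order of flatness: at a node the error of the previous
stage vanishes, so the new error is that error divided by [x - y].  As long as
the previous order is at least two, the derivative taken at a repeated node sees
the polynomial only. *)
Lemma flat_divdiff_rev N m f q s :
  (forall z, z \in N -> flat m z (f \- horner q)) ->
  {subset s <= N} -> (size s < m)%N ->
  forall z, z \in N -> flat (m - size s) z (divdiff_rev f s \- horner (newton q s)).
Proof.
move=> Hf; elim: s => [|y s IH] sN sm z zN; first by rewrite subn0; exact: Hf.
have yN : y \in N by apply: sN; rewrite mem_head.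
have {IH} IH := IH (fun u us => sN u (mem_behead (s := y :: s) us)) (ltnW sm).
rewrite -[(m - size s)%N]prednK ?subn_gt0 1?ltnW // -subnS in IH.
set k := (m - (size s).+1)%N in IH *.
set g := _ \- _ in IH.
have k0 : (0 < k)%N by rewrite subn_gt0.
have gy : g y = 0 by exact: flat_at (IH _ yN).
have gdy : is_derive y 1 g 0.
  by move: (IH y yN); rewrite -(prednK k0) => /flat_is_derive.
have ddE : divdiff_rev f s = g \+ horner (newton q s).
  by apply/funext => x; rewrite /g /= subrK.
have dd x : divdiff_rev f (y :: s) x - (newton q (y :: s)).[x] =
    if y == x then 0 else g x / (x - y).
  rewrite -divdiff_rev_horner /=.
  have -> : divdiff_rev (horner q) s = horner (newton q s).
    by apply/funext => u; rewrite divdiff_rev_horner.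
  case: eqVneq => [_|yx].
    rewrite ddE derive1E deriveD; last exact: derivable_horner; last by [].
    by rewrite derive_val add0r -derive1E subrr.
  rewrite ddE /= gy.
  have : y - x != 0 by rewrite subr_eq0.
  have : x - y != 0 by rewrite subr_eq0 eq_sym.
  by move=> *; field; apply/andP.
have [C gC] := IH z zN.
have [zy|zy] := eqVneq z y.
  (* At the node [y] itself, division by [x - y] lowers the order by one. *)
  exists (Num.max C 0); rewrite zy in gC *; near=> x.
  rewrite /= [X in `|X|]dd; case: eqVneq => [->|yx].
    by rewrite normr0 mulr_ge0 ?le_max ?lexx ?orbT.
  rewrite normrM normfV ler_pdivrMr ?normr_gt0 ?subr_eq0 1?eq_sym //.
  rewrite -mulrA -exprSr (le_trans (_ : _ <= C * `|x - y| ^+ k.+1)) //.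
    by near: x.
  by rewrite ler_wpM2r // le_max lexx.
(* Away from [y] the divisor is bounded below, and the spare order is dropped. *)
have dpos : 0 < `|z - y| / 2 by rewrite divr_gt0 // normr_gt0 subr_eq0.
exists (Num.max C 0 * (`|z - y| / 2)^-1); near=> x.
rewrite /= [X in `|X|]dd.
have xy : `|z - y| / 2 <= `|x - y|.
  have xz : `|x - z| < `|z - y| / 2.
    by rewrite distrC; near: x; exact: cvgr_dist_lt.
  have := ler_distD x z y; rewrite (distrC z x); lra.
have x1 : `|x - z| <= 1.
  by rewrite distrC; near: x; exact: cvgr_dist_le.
case: ifP => _; first by rewrite normr0 !mulr_ge0 ?le_max ?lexx ?orbT // invr_ge0 ltW.
rewrite normrM normfV mulrAC ler_pM //.
  rewrite (le_trans (_ : _ <= C * `|x - z| ^+ k.+1)) //; first by near: x.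
  rewrite (le_trans (_ : _ <= Num.max C 0 * `|x - z| ^+ k.+1)) //.
    by rewrite ler_wpM2r // le_max lexx.
  by rewrite ler_wpM2l ?le_max ?lexx ?orbT // exprS ler_piMl.
by rewrite lef_pV2 // posrE // (lt_le_trans dpos).
Unshelve. all: by end_near. Qed.

(** A function which agrees with a polynomial to high order at the nodes has the
same divided difference, even where the recursion takes derivatives. *)
Lemma divdiff_rev_eq N m f q s x :
  (forall z, z \in N -> flat m z (f \- horner q)) ->
  {subset x :: s <= N} -> (size s < m)%N ->
  divdiff_rev f s x = ddiff q (x :: s).
Proof.
move=> Hf sN sm; have xN : x \in N by apply: sN; rewrite mem_head.
have := flat_divdiff_rev Hf (fun u us => sN u (mem_behead (s := x :: s) us)) sm xN.
rewrite -[(m - _)%N]prednK ?subn_gt0 // => /flat_at /eqP.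
by rewrite subr_eq0 => /eqP.
Qed.

End Jets.

(** * Truncated powers and piecewise polynomial densities *)

Section TruncatedPowers.
Variable R : realType.
Implicit Types (N w s : seq R) (q : {poly R}).

Lemma flat_near k (z : R) (f g : R -> R) :
  (\forall x \near z, f x = g x) -> flat k z g -> flat k z f.
Proof.
move=> fg [C gC]; exists C; near=> x.
have -> : f x = g x by near: x.
by near: x.
Unshelve. all: by end_near. Qed.

(** Near a node [z] the truncated power is either [(X - t)^k] or 0, according to
the side of [t]; the idempotents glue these polynomial germs into one polynomial. *)
Lemma divdiff_truncpow N k (idem : R -> {poly R}) x s t :
  uniq N ->
  (forall z, z \in N -> ('X - z%:P) ^+ (size s).+1 %| idem z - 1) ->
  (forall z y, z \in N -> y \in N -> y != z ->
     ('X - y%:P) ^+ (size s).+1 %| idem z) ->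
  {subset x :: s <= N} -> t \notin N ->
  divdiff_rev (fun u => truncpow k (u - t)) s x =
  \sum_(z <- N) (if t < z then (kernel_poly (x :: s) k (idem z)).[t] else 0).
Proof.
move=> uN idem1 idem0 sN tN.
(* The polynomial with the same germ as the truncated power at each node. *)
pose q := \sum_(z <- N) (if t < z then ('X - t%:P) ^+ k * idem z else 0).
rewrite (@divdiff_rev_eq _ N (size s).+1 _ q) //; last first.
  move=> z zN; have tz : z != t by apply: contraNneq tN => <-.
  pose g := (if t < z then ('X - t%:P) ^+ k else 0) - q.
  apply: (@flat_near _ _ _ (horner g)).
    have [zt|zt|zE] := ltgtP t z; last by rewrite zE eqxx in tz.
    - near=> u; rewrite /= /g zt hornerD hornerN horner_exp hornerXsubC.
      rewrite /truncpow subr_ge0 ltW //.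
      by near: u; exact: lt_nbhsr.
    - near=> u; rewrite /= /g ltNge (ltW zt) /= hornerD hornerN horner0.
      rewrite /truncpow subr_ge0 leNgt.
      by have -> : u < t by near: u; exact: lt_nbhsl.
  apply: flat_horner; rewrite /g /q (big_rem z) //= opprD addrA.
  apply: dvdp_sub.
    case: ifP => _; last by rewrite subrr dvdp0.
    by rewrite -{1}[_ ^+ k]mulr1 -mulrBr dvdp_mull // -dvdpNr opprB idem1.
  rewrite big_seq; apply: (big_ind (fun r => _ %| r)); rewrite ?dvdp0 //.
    exact: dvdp_add.
  move=> y; rewrite mem_rem_uniq // inE => /andP[yz yN].
  case: ifP => _; rewrite ?dvdp0 // dvdp_mull // idem0 //.
  by rewrite eq_sym.
rewrite /q ddiff_sum; apply: eq_bigr => z _.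
by case: ifP => _; rewrite ?ddiff0 // horner_kernel_poly.
Unshelve. all: by end_near. Qed.

(** For [t] to the right of [a] and off the list [N], the summand of [z] is present
exactly when [t < z]; this is the shape of [divdiff_truncpow]. *)
Definition piecewise_poly (a : R) N (G : R -> {poly R}) (t : R) : R :=
  \sum_(z <- N) (horner (G z) \_ `[a, z]) t.

Local Notation mu := (@lebesgue_measure R).

Lemma integrable_poly_itv q a b :
  mu.-integrable setT (EFin \o (horner q \_ `[a, b])).
Proof.
rewrite -restrict_EFin; apply/(integrable_mkcond _ _).1 => //.
apply: continuous_compact_integrable; first exact: segment_compact.
by apply: continuous_subspaceT; exact: continuous_horner.
Qed.

Lemma Rintegral_poly_itv q a b : a < b ->
  (\int[mu]_(t in `[a, b]) (q^`()).[t])%R = q.[b] - q.[a].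
Proof.
move=> ab; rewrite /Rintegral (@continuous_FTC2 _ _ (horner q)) //.
- by apply: continuous_subspaceT; exact: continuous_horner.
- split => [x _||].
  + exact: derivable_horner.
  + by apply: cvg_at_right_filter; exact: continuous_horner.
  + by apply: cvg_at_left_filter; exact: continuous_horner.
- by move=> x _; rewrite derivE.
Qed.

Lemma piecewise_polyM q a N G t :
  q.[t] * piecewise_poly a N G t = piecewise_poly a N (fun z => q * G z) t.
Proof.
rewrite mulr_sumr; apply: eq_bigr => z _.
by rewrite /patch; case: ifP => _; rewrite ?mulr0 ?hornerM.
Qed.

Lemma integrable_piecewise_poly a N G :
  mu.-integrable setT (EFin \o piecewise_poly a N G).
Proof.
elim: N => [|z N IH].
  rewrite (_ : _ \o _ = cst 0%E); first exact: integrable0.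
  by apply/funext => t; rewrite /piecewise_poly /= big_nil.
rewrite (_ : _ \o _ = (EFin \o (horner (G z) \_ `[a, z])) \+ (EFin \o piecewise_poly a N G))%E.
  by apply: integrableD => //; exact: integrable_poly_itv.
by apply/funext => t; rewrite /piecewise_poly /= big_cons EFinD.
Qed.

Lemma Rintegral_piecewise_poly a N G (P : R -> {poly R}) :
  (forall z, z \in N -> a < z /\ (P z)^`() = G z) ->
  Rintegral mu setT (piecewise_poly a N G) =
  \sum_(z <- N) ((P z).[z] - (P z).[a]).
Proof.
elim: N => [|z N IH] HP.
  rewrite big_nil /Rintegral; under eq_integral do rewrite /piecewise_poly big_nil.
  by rewrite integral0.
rewrite big_cons -IH; last by move=> y yN; apply: HP; rewrite inE yN orbT.
have [az dPz] := HP z (mem_head _ _).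
rewrite -Rintegral_poly_itv // [X in _ = X + _]Rintegral_mkcond -RintegralD //; last 2 first.
- exact: integrable_poly_itv.
- exact: integrable_piecewise_poly.
by apply: eq_Rintegral => t _; rewrite /piecewise_poly big_cons dPz.
Qed.

Lemma piecewise_poly_out a b N G t : {subset N <= `[a, b]} ->
  ~ `[a, b]%classic t -> piecewise_poly a N G t = 0.
Proof.
move=> Nab tab; rewrite /piecewise_poly big_seq big1 // => z zN.
rewrite patchE memNset // => /= tz; apply: tab.
move: (Nab z zN) tz; rewrite /= !in_itv /= => /andP[_ zb] /andP[-> tz].
exact: le_trans tz zb.
Qed.

End TruncatedPowers.

(** * Spectral calculus and words in spectral projections *)

Lemma mulmx_conj (F : comUnitRingType) n (P D1 D2 : 'M[F]_n) : P \in unitmx ->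
  (invmx P *m D1 *m P) *m (invmx P *m D2 *m P) = invmx P *m (D1 *m D2) *m P.
Proof. by move=> uP; rewrite !mulmxA mulmxK. Qed.

(** [E1 B E0 = E1 (A + B) E0 - E1 A E0], and both terms are [z *: (E1 E0)]. *)
Lemma mulmx_cross (F : comNzRingType) n (A B E1 E0 : 'M[F]_n) z :
  E1 *m (A + B) = z *: E1 -> A *m E0 = z *: E0 -> E1 *m B *m E0 = 0.
Proof.
move=> hE1 hE0; apply: (addrI (E1 *m A *m E0)).
rewrite addr0 -mulmxDl -mulmxDr hE1 -(mulmxA E1 A E0) hE0.
by rewrite -(scalemxAl z E1 E0) -(scalemxAr z E1 E0).
Qed.

Section SpectralWords.
Variables (R : realType) (n : nat).
Local Notation M := 'M[R[i]]_n.
Implicit Types (A B H V : M) (f g : R -> R[i]) (S : seq R).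

Lemma scaleMl (a : R[i]) A B : a *: (A * B) = a *: A * B.
Proof. exact: scalemxAl. Qed.

Lemma scaleMr (a : R[i]) A B : a *: (A * B) = A * (a *: B).
Proof. exact: scalemxAr. Qed.

Definition spectrum H : seq R := [seq complex.Re (spectral_diag H 0 k) | k : 'I_n].

Lemma mem_spectrum H k : complex.Re (spectral_diag H 0 k) \in spectrum H.
Proof. by apply: map_f; rewrite mem_enum. Qed.

Lemma mxcalc_row f H (r : 'rV[R[i]]_n) :
  \row_(k < n) f (complex.Re (spectral_diag H 0 k)) = r ->
  mxcalc f H = invmx (spectralmx H) *m diag_mx r *m spectralmx H.
Proof. by move=> <-. Qed.

Lemma eq_mxcalc f g H : {in spectrum H, f =1 g} -> mxcalc f H = mxcalc g H.
Proof.
move=> fg; apply: mxcalc_row.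
by apply/rowP => k; rewrite !mxE fg // mem_spectrum.
Qed.

Lemma mxcalcM f g H : mxcalc (fun x => f x * g x) H = mxcalc f H *m mxcalc g H.
Proof.
pose r (h : R -> R[i]) : 'rV_n := \row_k h (complex.Re (spectral_diag H 0 k)).
transitivity (invmx (spectralmx H) *m (diag_mx (r f) *m diag_mx (r g)) *m spectralmx H).
  rewrite (mulmx_diag (r f) (r g)); apply: mxcalc_row.
  by apply/rowP => k; rewrite !mxE.
exact: esym (mulmx_conj (diag_mx (r f)) (diag_mx (r g)) (spectral_unit H)).
Qed.

Lemma mxcalc1 H : mxcalc (fun=> 1) H = 1%:M.
Proof.
rewrite /mxcalc (_ : \row_k 1 = const_mx 1) ?diag_const_mx; last first.
  by apply/rowP => k; rewrite !mxE.
by rewrite mulmx1 mulVmx // spectral_unit.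
Qed.

Lemma mxcalcZ (c : R[i]) f H : mxcalc (fun x => c * f x) H = c *: mxcalc f H.
Proof.
rewrite /mxcalc (_ : \row_k _ = c *: \row_k f (complex.Re (spectral_diag H 0 k))).
  by rewrite linearZ -scalemxAr -scalemxAl.
by apply/rowP => k; rewrite !mxE.
Qed.

Lemma mxcalc_sum (I : Type) (r : seq I) (F : I -> R -> R[i]) H :
  mxcalc (fun x => \sum_(i <- r) F i x) H = \sum_(i <- r) mxcalc (F i) H.
Proof.
rewrite -mulmx_suml -mulmx_sumr -linear_sum; apply: mxcalc_row.
by apply/rowP => k; rewrite summxE !mxE; apply: eq_bigr => j _; rewrite mxE.
Qed.

Lemma mxcalc_id H : H \is hermsymmx -> mxcalc (fun x => x%:C) H = H.
Proof.
move=> hH; have /orthomx_spectralP HE := hermitian_normalmx hH.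
rewrite [RHS]HE; apply: mxcalc_row; apply/rowP => k; rewrite mxE.
have /mxOverP /(_ 0 k) := hermitian_spectral_diag_real hH.
by case: (spectral_diag H 0 k) => a b; rewrite complex_real => /eqP ->.
Qed.

Lemma mxcalcX H N : H \is hermsymmx -> mxcalc (fun x => (x ^+ N)%:C) H = H ^+ N.
Proof.
move=> hH; elim: N => [|N IH].
  rewrite expr0 -[RHS](mxcalc1 H); congr mxcalc; exact/funext.
rewrite exprS -[X in X * _](mxcalc_id hH) -IH -[RHS]mxcalcM; congr mxcalc.
by apply/funext => x; rewrite exprS rmorphM.
Qed.

Definition eigenproj H (z : R) : M := spectral_measure H [set z].

(** On the spectrum, [f] is the combination of indicators of points with
coefficients [f z]. *)
Lemma mxcalc_eigenproj S f H : uniq S -> {subset spectrum H <= S} ->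
  mxcalc f H = \sum_(z <- S) f z *: eigenproj H z.
Proof.
move=> uS HS.
transitivity (mxcalc (fun x => \sum_(z <- S) f z * (\1_[set z] x)%:C) H).
  apply: eq_mxcalc => x /HS xS; rewrite (big_rem x) //= indicE mem_set //=.
  rewrite mulr1 big_seq big1 ?addr0 // => y; rewrite mem_rem_uniq // inE.
  move=> /andP[yx _]; rewrite indicE memNset /= ?mulr0 // => xy.
  by rewrite xy eqxx in yx.
by rewrite mxcalc_sum; apply: eq_bigr => z _; rewrite mxcalcZ.
Qed.

Lemma mulmx_eigenproj H z : H \is hermsymmx -> H *m eigenproj H z = z%:C *: eigenproj H z.
Proof.
move=> hH; rewrite -[X in X *m _](mxcalc_id hH) -mxcalcM -mxcalcZ.
congr mxcalc; apply/funext => x; rewrite indicE.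
by case: (boolP (x \in _)) => [/set_mem -> //|_]; rewrite !mulr0.
Qed.

Lemma eigenproj_mulmx H z : H \is hermsymmx -> eigenproj H z *m H = z%:C *: eigenproj H z.
Proof.
move=> hH; rewrite -[X in _ *m X](mxcalc_id hH) -mxcalcM -mxcalcZ.
congr mxcalc; apply/funext => x; rewrite indicE.
by case: (boolP (x \in _)) => [/set_mem -> |_]; rewrite ?mul0r ?mulr0 // mulrC.
Qed.

Lemma spectral_measure_restr S H (D : set R) : {subset spectrum H <= S} ->
  spectral_measure H D = spectral_measure H (D `&` [set` S]).
Proof.
move=> HS; apply: eq_mxcalc => x /HS xS; rewrite !indicE in_setI.
by rewrite [X in _ && X]mem_set ?andbT.
Qed.

(** The coefficient of [t^j] in [(A + t B)^N], for noncommuting [A] and [B]. *)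
Fixpoint pencil_coef (A B : M) N j : M :=
  if N is N'.+1 then
    pencil_coef A B N' j * A + (if j is j'.+1 then pencil_coef A B N' j' * B else 0)
  else (if j == 0%N then 1 else 0).

Lemma pencil_coefS A B N j : pencil_coef A B N.+1 j =
  pencil_coef A B N j * A + (if j is j'.+1 then pencil_coef A B N j' * B else 0).
Proof. by []. Qed.

Lemma pencil_coef_small A B N j : (N < j)%N -> pencil_coef A B N j = 0.
Proof.
elim: N j => [|N IH] [|j] // Nj.
by rewrite pencil_coefS !IH ?mul0r ?addr0 // ltnW.
Qed.

Lemma pencil_exp A B N (t : R[i]) :
  (A + t *: B) ^+ N = \sum_(j < N.+1) t ^+ j *: pencil_coef A B N j.
Proof.
elim: N => [|N IH]; first by rewrite big_ord1 /= !expr0 scale1r.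
rewrite exprSr mulrDr {1}IH mulr_suml.
have -> : \sum_(j < N.+2) t ^+ j *: pencil_coef A B N.+1 j =
  \sum_(j < N.+2) (t ^+ j *: pencil_coef A B N j) * A +
  \sum_(j < N.+2) t ^+ j *: (if j : nat is j'.+1 then pencil_coef A B N j' * B else 0).
  rewrite -big_split; apply: eq_bigr => j _.
  by rewrite pencil_coefS scalerDr scaleMl.
congr (_ + _).
  by rewrite [RHS]big_ord_recr /= pencil_coef_small // scaler0 mul0r addr0.
rewrite big_ord_recl scaler0 add0r IH mulr_suml; apply: eq_bigr => j _.
by rewrite exprS -!scalerA -!scaleMr -!scaleMl.
Qed.

Definition taylor_tail (H0 V : M) p N : M :=
  (H0 + V) ^+ N - \sum_(j < p) pencil_coef H0 V N j.

Lemma taylor_tailSS H0 V p N : taylor_tail H0 V p.+1 N.+1 =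
  taylor_tail H0 V p.+1 N * H0 + taylor_tail H0 V p N * V.
Proof.
rewrite /taylor_tail exprSr mulrDr !mulrBl addrACA; congr (_ + _).
rewrite -opprD; congr (- _); rewrite !mulr_suml.
under eq_bigr do rewrite pencil_coefS.
rewrite big_split /=; congr (_ + _).
by rewrite big_ord_recl add0r.
Qed.

Lemma taylor_tailS0 H0 V p : taylor_tail H0 V p.+1 0 = 0.
Proof.
by rewrite /taylor_tail expr0 big_ord_recl /= big1 ?addr0 ?subrr // => -[].
Qed.

Lemma taylor_tail0 H0 V N : taylor_tail H0 V 0 N = (H0 + V) ^+ N.
Proof. by rewrite /taylor_tail big_ord0 subr0. Qed.

(** Words are stored last letter first, the order in which the recursion of
divided differences consumes the nodes. *)
Fixpoint words S p : seq (p.+1.-tuple R) :=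
  if p is p'.+1 return seq (p.+1.-tuple R)
  then [seq cons_tuple z w | w <- words S p', z <- S]
  else [seq [tuple z] | z <- S].

(** For [w = [:: z_(p+1); ...; z_1]] this is
[E_(H0+V)(z_1) V E_H0(z_2) V ... V E_H0(z_(p+1))]. *)
Fixpoint mxword (H0 V : M) (w : seq R) : M :=
  if w is z :: s then
    if s is [::] then eigenproj (H0 + V) z
    else mxword H0 V s * V * eigenproj H0 z
  else 0.

Lemma mxword_cons H0 V z (s : seq R) : (0 < size s)%N ->
  mxword H0 V (z :: s) = mxword H0 V s * V * eigenproj H0 z.
Proof. by case: s. Qed.

Arguments ddiff : simpl never.
Arguments mxword : simpl never.

(** Both sides satisfy the same recursion in [N].  On the left it is
[taylor_tailSS]; on the right, [H0] multiplies the last projection by its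
eigenvalue, [1 = sum_z E_H0(z)] inserted after [V] appends a letter, and the
coefficients match by [ddiffX]. *)
Lemma taylor_tail_words S H0 V p N : uniq S ->
  H0 \is hermsymmx -> H0 + V \is hermsymmx ->
  {subset spectrum H0 <= S} -> {subset spectrum (H0 + V) <= S} ->
  taylor_tail H0 V p N =
  \sum_(w <- words S p) (ddiff 'X^N w)%:C *: mxword H0 V w.
Proof.
move=> uS hH0 hH1 S0 S1.
elim: N p => [|N IH] [|p].
- rewrite taylor_tail0 -mxcalcX // (mxcalc_eigenproj _ uS S1) big_map.
  by apply: eq_bigr => z _; rewrite /ddiff /= hornerXn.
- rewrite taylor_tailS0 big1 // => w _; case/tupleP: w => z w.
  by rewrite ddiff_small ?scale0r // expr0 size_poly1 size_tuple.
- rewrite taylor_tail0 -mxcalcX // (mxcalc_eigenproj _ uS S1) big_map.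
  by apply: eq_bigr => z _; rewrite /ddiff /= hornerXn.
rewrite taylor_tailSS !IH big_allpairs_dep /= big_allpairs_dep /=.
rewrite !mulr_suml -big_split; apply: eq_bigr => w _ /=.
have sw : (0 < size w)%N by rewrite size_tuple.
rewrite -[X in _ + X]mulr1 -[X in _ + _ * X](mxcalc1 H0).
rewrite (mxcalc_eigenproj _ uS S0) mulr_suml mulr_sumr -big_split.
apply: eq_bigr => z _.
rewrite /= exprS ddiffX rmorphD rmorphM scalerDl.
congr (_ + _); rewrite mxword_cons //.
  rewrite -scaleMl -mulrA -[_ * H0]/(_ *m H0) eigenproj_mulmx // -scaleMr scalerA.
  by rewrite mulrC.
by rewrite scale1r -!scaleMl.
Qed.

Lemma mxword_prod H0 V p (w : seq R) : size w = p.+1 ->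
  eigenproj (H0 + V) (nth 0 (rev w) 0) *
    \prod_(i < p) (V * eigenproj H0 (nth 0 (rev w) i.+1)) =
  mxword H0 V w.
Proof.
elim: p w => [|p IH] [|z s] //= [sp].
  by case: s sp => // _; rewrite big_ord0 mulr1.
have ss : size (rev s) = p.+1 by rewrite size_rev.
have -> : \prod_(i < p.+1) (V * eigenproj H0 (rev (z :: s))`_i.+1) =
    \prod_(i < p) (V * eigenproj H0 (rev s)`_i.+1) * (V * eigenproj H0 z).
  rewrite big_ord_recr /= rev_cons nth_rcons ss ltnn eqxx.
  apply: (congr1 (fun P : M => P * (V * eigenproj H0 z))).
  by apply: eq_bigr => i _; rewrite nth_rcons ss ltnS ltn_ord.
rewrite mxword_cons ?sp // -(IH s sp) rev_cons nth_rcons ss ltn0Sn.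
by rewrite mulrA -[RHS]mulrA.
Qed.

(** The first two letters already give [E_(H0+V)(z) V E_H0(z) = 0]. *)
Lemma mxword_diag H0 V z k : H0 \is hermsymmx -> H0 + V \is hermsymmx ->
  mxword H0 V (nseq k.+2 z) = 0.
Proof.
move=> h0 h1; elim: k => [|k IH]; last first.
  by rewrite (mxword_cons _ _ _ (s := nseq k.+2 z)) // IH !mul0r.
rewrite (mxword_cons _ _ _ (s := [:: z])) //.
exact: mulmx_cross (eigenproj_mulmx z h1) (mulmx_eigenproj z h0).
Qed.

End SpectralWords.

(** * The Taylor remainder of a monomial *)

Section MonomialRemainder.
Variables (R : realType).

Lemma derive1n_horner k (q : {poly R}) : derive1n k (horner q) = horner (q^`(k)).
Proof.
elim: k => [|k IH]; first by rewrite derivn0.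
by rewrite derive1nS IH derivnS; apply/funext => x; rewrite derivE.
Qed.

Lemma Re_real_mul (x : R) (c : R[i]) : complex.Re (x%:C * c) = x * complex.Re c.
Proof. by case: c => a b /=; rewrite mul0r subr0. Qed.

Lemma Im_real_mul (x : R) (c : R[i]) : complex.Im (x%:C * c) = x * complex.Im c.
Proof. by case: c => a b /=; rewrite mul0r addr0. Qed.

Lemma Re_sum (I : Type) (r : seq I) (F : I -> R[i]) :
  complex.Re (\sum_(i <- r) F i) = \sum_(i <- r) complex.Re (F i).
Proof. by apply: (big_morph (@complex.Re R)) => // -[a b] [c d]. Qed.

Lemma Im_sum (I : Type) (r : seq I) (F : I -> R[i]) :
  complex.Im (\sum_(i <- r) F i) = \sum_(i <- r) complex.Im (F i).
Proof. by apply: (big_morph (@complex.Im R)) => // -[a b] [c d]. Qed.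

(** Taylor coefficients at 0 of a polynomial curve, read off componentwise. *)
Lemma cderiven_poly k m (c : nat -> R[i]) :
  cderiven k (fun t : R => \sum_(j < m) t%:C ^+ j * c j) 0 =
  (k`!)%:R * (if (k < m)%N then c k else 0).
Proof.
have E (g : R[i] -> R) : derive1n k (fun t : R => \sum_(j < m) t ^+ j * g (c j)) 0 =
    (if (k < m)%N then g (c k) else 0) *+ k`!.
  have -> : (fun t : R => \sum_(j < m) t ^+ j * g (c j)) =
      horner (\poly_(j < m) g (c j)).
    by apply/funext => t; rewrite horner_poly; apply: eq_bigr => j _; rewrite mulrC.
  by rewrite derive1n_horner horner_coef0 coef_derivn addn0 coef_poly ffactnn.
have ReE : (fun s : R => complex.Re (\sum_(j < m) s%:C ^+ j * c j)) =
    (fun t : R => \sum_(j < m) t ^+ j * complex.Re (c j)).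
  apply/funext => s; rewrite Re_sum; apply: eq_bigr => j _.
  by rewrite -rmorphXn Re_real_mul.
have ImE : (fun s : R => complex.Im (\sum_(j < m) s%:C ^+ j * c j)) =
    (fun t : R => \sum_(j < m) t ^+ j * complex.Im (c j)).
  apply/funext => s; rewrite Im_sum; apply: eq_bigr => j _.
  by rewrite -rmorphXn Im_real_mul.
rewrite /cderiven ReE ImE !E mulr_natl.
set d := (if _ then c k else _).
have -> : (if (k < m)%N then complex.Re (c k) else 0) = complex.Re d.
  by rewrite /d; case: ifP.
have -> : (if (k < m)%N then complex.Im (c k) else 0) = complex.Im d.
  by rewrite /d; case: ifP.
case: d => a b; elim: (k`!) => [|l IH] //.
by rewrite [RHS]mulrS -IH !mulrS.
Qed.

Lemma hermsymmx_pencil n (H V : 'M[R[i]]_n) (t : R) :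
  H \is hermsymmx -> V \is hermsymmx -> H + t%:C *: V \is hermsymmx.
Proof.
move=> /is_hermitianmxP; rewrite expr0 scale1r => hH.
move=> /is_hermitianmxP; rewrite expr0 scale1r => hV.
apply/is_hermitianmxP; rewrite expr0 scale1r; apply/matrixP => a b.
rewrite !mxE rmorphD rmorphM /=.
have -> : Num.conj (t%:C : R[i]) = t%:C by apply: conj_Creal; apply/complex_realP; exists t.
by rewrite {1}hH {1}hV !mxE.
Qed.

Lemma hermsymmxD n (H V : 'M[R[i]]_n) :
  H \is hermsymmx -> V \is hermsymmx -> H + V \is hermsymmx.
Proof. by move=> hH hV; have := hermsymmx_pencil 1 hH hV; rewrite scale1r. Qed.

(** The curve [t -> (H0 + t V)^N] is polynomial, so its Taylor terms at 0 are its
coefficients. *)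
Lemma remainder_monomial n p N (H0 V : 'M[R[i]]_n) :
  H0 \is hermsymmx -> V \is hermsymmx ->
  remainder p H0 V (fun x => (x ^+ N)%:C) = taylor_tail H0 V p N.
Proof.
move=> hH hV; rewrite /remainder mxcalcX; last exact: hermsymmxD.
congr (_ - _); apply: eq_bigr => j _; apply/matrixP => a b; rewrite !mxE.
have -> : (fun s : R => mxcalc (fun x => (x ^+ N)%:C) (H0 + s%:C *: V) a b) =
    (fun s : R => \sum_(i < N.+1) s%:C ^+ i * pencil_coef H0 V N i a b).
  apply/funext => s; rewrite mxcalcX; last exact: hermsymmx_pencil.
  by rewrite pencil_exp summxE; apply: eq_bigr => i _; rewrite mxE.
rewrite (cderiven_poly _ _ (fun i => pencil_coef H0 V N i a b)).
rewrite mulrA mulVf ?mul1r; last by rewrite pnatr_eq0 -lt0n fact_gt0.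
case: ltnP => // Nj; by rewrite pencil_coef_small // mxE.
Qed.

End MonomialRemainder.

(** * Charges: uniqueness and finite support *)

Section Charges.
Local Open Scope ereal_scope.

Section ChargeUniqueness.
Context d (T : measurableType d) (R : realType).
Implicit Types nu : {charge set T -> \bar R}.

(** Sets on which two charges of equal total mass agree form a Dynkin system. *)
Lemma charge_eq_pi_system nu1 nu2 (G : set (set T)) :
  measurable `<=` <<s G >> -> G `<=` measurable -> setI_closed G ->
  nu1 setT = nu2 setT -> (forall A, G A -> nu1 A = nu2 A) ->
  forall A, measurable A -> nu1 A = nu2 A.
Proof.
move=> GT Gm GI nuT nuG A mA.
pose H := [set B | measurable B /\ nu1 B = nu2 B].
suff sub : <<s G >> `<=` H by have [] := sub _ (GT _ mA).
rewrite -setI_closed_g_dynkin_g_sigma_algebra //.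
apply: smallest_sub; last by move=> B GB; split; [exact: Gm|exact: nuG].
split.
- by split.
- move=> B [mB nuB]; split; first exact: measurableC.
  by rewrite -setTD !chargeD // nuT !setTI nuB.
move=> F tF HF.
have mF n : measurable (F n) by have [] := HF n.
have mUF : measurable (\bigcup_k F k) by exact: bigcupT_measurable.
split => //.
have c1 := @charge_semi_sigma_additive _ _ _ nu1 F mF tF mUF.
have c2 := @charge_semi_sigma_additive _ _ _ nu2 F mF tF mUF.
have eqF : (fun n => \sum_(0 <= i < n) nu1 (F i)) = (fun n => \sum_(0 <= i < n) nu2 (F i)).
  by apply/funext => n; apply: eq_bigr => i _; have [] := HF i.
rewrite eqF in c1.
by rewrite -(cvg_lim _ c1) // -(cvg_lim _ c2).
Qed.

End ChargeUniqueness.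

(** The Hahn decomposition inside [charge_integral] is a choice; this keeps it
abstract. *)
Lemma charge_integralE d (T : measurableType d) (R : realType)
    (nu : {charge set T -> \bar R}) :
  exists P N (hahn : hahn_decomposition nu P N), forall D (g : T -> R),
    charge_integral nu D g =
    (Rintegral (jordan_pos hahn) D g - Rintegral (jordan_neg hahn) D g)%R.
Proof. by do 3 eexists; move=> D g; reflexivity. Qed.

Lemma jordan_null d (T : measurableType d) (R : realType)
    (nu : {charge set T -> \bar R}) P N (hahn : hahn_decomposition nu P N)
    (B : set T) : measurable B ->
  (forall C, measurable C -> C `<=` B -> nu C = 0) ->
  jordan_pos hahn B = 0 /\ jordan_neg hahn B = 0.
Proof.
move=> mB nuB; have [[mP _] [mN _] _ _] := hahn; split.
  rewrite jordan_posE cjordan_posE /crestr0 mem_set // /crestr nuB //.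
  exact: measurableI.
rewrite jordan_negE cjordan_negE /crestr0 mem_set // /crestr nuB ?oppe0 //.
exact: measurableI.
Qed.

Section FiniteSupport.
Import HBNNSimple.
Context d (T : measurableType d) (R : realType).
Variables (L : seq T).
Hypotheses (uL : uniq L) (mL : forall x : T, x \in L -> measurable [set x]).
Implicit Types (mu : {finite_measure set T -> \bar R}) (nu : {charge set T -> \bar R}).

Lemma measurable_support : measurable [set` L].
Proof.
have -> : [set` L] = \big[setU/set0]_(x <- L) [set x].
  apply/seteqP; split => y; rewrite -bigcup_seq /=.
    by move=> yL; exists y.
  by move=> [x xL ->].
by rewrite big_seq; apply: bigsetU_measurable => x; exact: mL.
Qed.

Let projE (h : {nnsfun T >-> R}) x :
  proj_nnsfun h measurable_support x = (h x * \1_[set` L] x)%R.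
Proof. by []. Qed.

Let sintegral_proj mu (h : {nnsfun T >-> R}) : mu (~` [set` L]) = 0 ->
  sintegral mu h = sintegral mu (proj_nnsfun h measurable_support).
Proof.
move=> muL; rewrite -!integralT_nnsfun; apply: ge0_ae_eq_integral => //.
- exact/measurable_EFinP.
- exact/measurable_EFinP.
- by move=> x _; rewrite lee_fin.
- by move=> x _; rewrite lee_fin.
exists (~` [set` L]); split => //; first exact/measurableC/measurable_support.
move=> x hx xL; apply: hx => _.
by rewrite projE indicE mem_set // mulr1.
Qed.

(** The integral is a supremum over simple functions below [f]; multiplying such a
function by the indicator of [L] keeps it below [f] and does not change its
integral.  The argument works for arbitrary [f], so that divided differences can
be integrated as they stand. *)
Lemma ge0_integral_finite_support mu (f : T -> \bar R) :
  mu (~` [set` L]) = 0 -> (forall x, 0 <= f x) ->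
  \int[mu]_x f x = \int[mu]_x (f \_ [set` L]) x.
Proof.
move=> muL f0; rewrite !ge0_integralTE //; last first.
  by move=> x; rewrite patchE; case: ifP.
apply/eqP; rewrite eq_le; apply/andP; split.
  apply: ge_ereal_sup => _ [h hf <-]; apply: ereal_sup_ubound.
  exists (proj_nnsfun h measurable_support); last by rewrite -sintegral_proj.
  move=> x; rewrite projE patchE indicE; case: (boolP (x \in _)) => xL.
    by rewrite mulr1.
  by rewrite mulr0.
apply: le_ereal_sup => _ [h hf <-]; exists h => // x; apply: le_trans (hf x) _.
by rewrite patchE; case: ifP.
Qed.

Lemma integral_finite_support mu (f : T -> \bar R) :
  mu (~` [set` L]) = 0 -> \int[mu]_x f x = \int[mu]_x (f \_ [set` L]) x.
Proof.
move=> muL; rewrite integralE [RHS]integralE; congr (_ - _).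
  by rewrite ge0_integral_finite_support // funepos_restrict.
by rewrite ge0_integral_finite_support // funeneg_restrict.
Qed.

Lemma Rintegral_finite_support mu (f : T -> R) : mu (~` [set` L]) = 0 ->
  (\int[mu]_x f x)%R = (\sum_(x <- L) f x * fine (mu [set x]))%R.
Proof.
move=> muL.
transitivity (\int[mu]_x (\sum_(y <- L) f y * \1_[set y] x))%R.
  rewrite /Rintegral integral_finite_support //; congr fine.
  apply: eq_integral => x _; rewrite patchE; case: ifPn => [/set_mem /= xL|].
    rewrite (big_rem x) //= indicE mem_set // mulr1 big_seq big1 ?addr0 // => y.
    rewrite mem_rem_uniq // inE => /andP[yx _]; rewrite indicE memNset ?mulr0 //.
    by move=> /= xy; rewrite xy eqxx in yx.
  move=> /negP xL; rewrite big_seq big1 // => y yL.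
  rewrite indicE memNset ?mulr0 // => /= xy; apply: xL; apply/mem_set => /=.
  by rewrite xy.
have intL (s : seq T) : {subset s <= L} ->
    mu.-integrable setT (EFin \o (fun x => \sum_(y <- s) f y * \1_[set y] x))%R /\
    (\int[mu]_x (\sum_(y <- s) f y * \1_[set y] x))%R =
    (\sum_(x <- s) f x * fine (mu [set x]))%R.
  elim: s => [|z s IH] sL.
    rewrite big_nil; split.
      rewrite (_ : _ \o _ = cst 0); first exact: integrable0.
      by apply/funext => x; rewrite /= big_nil.
    rewrite /Rintegral; under eq_integral do rewrite big_nil.
    by rewrite integral0.
  have [IH1 IH2] := IH (fun u us => sL u (mem_behead (s := z :: s) us)).
  have mz : measurable [set z] by apply/mL/sL/mem_head.
  have i1 : mu.-integrable setT (EFin \o (\1_[set z] : T -> R)).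
    exact: integrable_indic.
  have iz : mu.-integrable setT (EFin \o (fun x => f z * \1_[set z] x))%R.
    exact: (integrableZl measurableT (f z) i1).
  split.
    rewrite (_ : _ \o _ = (EFin \o (fun x => f z * \1_[set z] x)%R) \+
      (EFin \o (fun x => \sum_(y <- s) f y * \1_[set y] x)%R)).
      exact: integrableD.
    by apply/funext => x; rewrite /= big_cons EFinD.
  under eq_Rintegral do rewrite big_cons.
  rewrite RintegralD // IH2 big_cons RintegralZl //; congr (_ * _ + _)%R.
  by rewrite /Rintegral integral_indic // setIT.
by have [] := intL L (fun _ h => h).
Qed.

Lemma charge_integral_finite_support nu D (f : T -> R) :
  (forall B, measurable B -> B `<=` ~` [set` L] -> nu B = 0) ->
  charge_integral nu D f = (\sum_(x <- L) (f \_ D) x * fine (nu [set x]))%R.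
Proof.
move=> nuL; have [P [N [hahn ->]]] := charge_integralE nu.
have [p0 n0] := jordan_null hahn (measurableC measurable_support) nuL.
rewrite !(Rintegral_mkcond _ D) !Rintegral_finite_support // -sumrB.
rewrite big_seq [RHS]big_seq; apply: eq_bigr => x xL; rewrite -mulrBr; congr (_ * _)%R.
have mx := mL xL.
rewrite (jordan_decomp hahn mx) /cadd /= cscaleN1 fineB //; exact: fin_num_measure.
Qed.

End FiniteSupport.

End Charges.

(** * Polynomials converging to the indicator of a half-line *)

Section StepPolynomials.
Variable R : realType.
Implicit Types (a b x u : R).

Lemma bernoulli m (y : R) : -1 <= y -> 1 + m%:R * y <= (1 + y) ^+ m.
Proof.
move=> y1; elim: m => [|m IH]; first by rewrite mul0r addr0 expr0.
have y0 : 0 <= 1 + y by lra.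
rewrite exprSr; apply: le_trans (ler_wpM2r y0 IH).
have : 0 <= m%:R * (y * y) by rewrite mulr_ge0 // -expr2 sqr_ge0.
rewrite -natr1; nra.
Qed.

(** Bernoulli's inequality with [y = - u^n] and exponent [2^n]. *)
Lemma exprn_exprn_low u n : 0 <= u <= 1 ->
  1 - (2 * u) ^+ n <= (1 - u ^+ n) ^+ (2 ^ n) <= 1.
Proof.
move=> /andP[u0 u1].
have un0 : 0 <= u ^+ n by exact: exprn_ge0.
have un1 : u ^+ n <= 1 by exact: exprn_ile1.
apply/andP; split; last by apply: exprn_ile1; lra.
apply: le_trans (bernoulli (2 ^ n) (y := - u ^+ n) _); last by lra.
by rewrite exprMn natrX mulrN.
Qed.

(** [(1 - u^n)^m (1 + u^n)^m <= 1], and the second factor is at least [m u^n]. *)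
Lemma exprn_exprn_high u n : 0 < u <= 1 ->
  0 <= (1 - u ^+ n) ^+ (2 ^ n) <= ((2 * u)^-1) ^+ n.
Proof.
move=> /andP[u0 u1].
have un0 : 0 <= u ^+ n by rewrite exprn_ge0 // ltW.
have un1 : u ^+ n <= 1 by rewrite exprn_ile1 // ltW.
have q0 : 0 <= (1 - u ^+ n) ^+ (2 ^ n) by apply: exprn_ge0; lra.
rewrite q0 /= exprVn -[leRHS]mul1r ler_pdivlMr; last by rewrite exprn_gt0 // mulr_gt0.
have bern : (2 * u) ^+ n <= (1 + u ^+ n) ^+ (2 ^ n).
  apply: le_trans (bernoulli _ _); last by lra.
  by rewrite exprMn natrX lerDr.
apply: le_trans (ler_wpM2l q0 bern) _; rewrite -exprMn exprn_ile1 //; nra.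
Qed.

(** On [|x - a| <= b] the affine function in the first factor takes values in
[0, 1], with [1/2] at [a], so [(1 - u^n)^(2^n)] tends to 1 on the left of [a] and
to 0 on its right.  At [a] itself this limit would be [exp(-1)]; the second
factor vanishes there and tends to 1 elsewhere. *)
Definition step_poly (a b : R) (n : nat) : {poly R} :=
  (1 - ((2 * b)^-1 *: ('X - a%:P) + (2^-1)%:P) ^+ n) ^+ (2 ^ n)
  * (1 - (1 - (b^-1 *: ('X - a%:P)) ^+ 2) ^+ n).

Lemma horner_step_poly a b n x : (step_poly a b n).[x] =
  (1 - ((2 * b)^-1 * (x - a) + 2^-1) ^+ n) ^+ (2 ^ n)
  * (1 - (1 - (b^-1 * (x - a)) ^+ 2) ^+ n).
Proof. by rewrite /step_poly !hornerE. Qed.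

Lemma step_factors a b x : 0 < b -> `|x - a| <= b ->
  0 <= (2 * b)^-1 * (x - a) + 2^-1 <= 1 /\ 0 <= 1 - (b^-1 * (x - a)) ^+ 2 <= 1.
Proof.
move=> b0; rewrite ler_norml => /andP[xa1 xa2].
set t := b^-1 * (x - a).
have t1 : -1 <= t by rewrite /t mulrC ler_pdivlMr // mulN1r.
have t2 : t <= 1 by rewrite /t mulrC ler_pdivrMr // mul1r.
have -> : (2 * b)^-1 * (x - a) = t / 2 by rewrite /t; field; rewrite gt_eqF.
split; nra.
Qed.

Lemma step_poly_bound a b n x : 0 < b -> `|x - a| <= b -> `|(step_poly a b n).[x]| <= 1.
Proof.
move=> b0 xa; have [/andP[u0 u1] /andP[v0 v1]] := step_factors b0 xa.
rewrite horner_step_poly normrM.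
have aux (y : R) : 0 <= y <= 1 -> 0 <= 1 - y ^+ n <= 1.
  move=> /andP[y0 y1]; have := exprn_ge0 n y0; have := exprn_ile1 n y0 y1.
  by move=> ? ?; apply/andP; split; lra.
have /andP[q0 q1] := aux _ (introT andP (conj u0 u1)).
have /andP[r0 r1] := aux _ (introT andP (conj v0 v1)).
rewrite (ger0_norm r0) ger0_norm ?exprn_ge0 //.
by rewrite mulr_ile1 // ?exprn_ge0 // exprn_ile1.
Qed.

Lemma step_poly_cvg a b x : 0 < b -> `|x - a| <= b ->
  (step_poly a b n).[x] @[n --> \oo] --> (\1_[set y | y < a] x : R).
Proof.
move=> b0 xa; have [/andP[u0 u1] /andP[v0 v1]] := step_factors b0 xa.
rewrite (_ : (fun n => _) = fun n => (1 - ((2 * b)^-1 * (x - a) + 2^-1) ^+ n) ^+ (2 ^ n)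
  * (1 - (1 - (b^-1 * (x - a)) ^+ 2) ^+ n)); last first.
  by apply/funext => n; rewrite horner_step_poly.
have uE : 2 * ((2 * b)^-1 * (x - a) + 2^-1) = b^-1 * (x - a) + 1.
  by field; rewrite gt_eqF.
move: u0 u1 v0 v1 uE; set u := _ + 2^-1; set v := 1 - _ ^+ 2 => u0 u1 v0 v1 uE.
have [xa0|xNa] := eqVneq x a.
  rewrite indicE memNset /= ?xa0 ?ltxx //.
  apply: cvg_near_cst; apply: nearW => n.
  by rewrite /v xa0 subrr mulr0 expr0n subr0 expr1n subrr mulr0.
have v1' : v < 1.
  rewrite ltrBlDr ltrDl exprn_even_gt0 //= mulf_neq0 ?subr_eq0 //.
  by rewrite invr_eq0 gt_eqF.
have vn : (1 - v ^+ n) @[n --> \oo] --> (1 - 0 : R).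
  apply: cvgB; first exact: cvg_cst.
  by apply: cvg_expr; rewrite ger0_norm.
suff qn : (1 - u ^+ n) ^+ (2 ^ n) @[n --> \oo] --> (\1_[set y | y < a] x : R).
  rewrite subr0 in vn; rewrite -[X in _ --> X]mulr1; exact: (cvgM qn vn).
have [xa1|ax1] := ltP x a.
  rewrite indicE mem_set //.
  have ult : 2 * u < 1 by rewrite uE gtrDr pmulr_rlt0 ?invr_gt0 // subr_lt0.
  apply: (@squeeze_cvgr _ _ _ _ (fun n => 1 - (2 * u) ^+ n) (fun=> 1)).
  - by apply: nearW => n; apply: exprn_exprn_low; rewrite u0.
  - rewrite -[X in _ --> X]subr0; apply: cvgB; first exact: cvg_cst.
    by apply: cvg_expr; rewrite ger0_norm // mulr_ge0.
  - exact: cvg_cst.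
have {}ax1 : a < x by rewrite lt_neqAle eq_sym xNa.
rewrite indicE memNset /=; last by apply/negP; rewrite -leNgt ltW.
have ugt : 1 < 2 * u by rewrite uE ltrDr mulr_gt0 ?invr_gt0 // subr_gt0.
have up : 0 < u by lra.
apply: (@squeeze_cvgr _ _ _ _ (fun=> 0) (fun n => ((2 * u)^-1) ^+ n)).
- by apply: nearW => n; apply: exprn_exprn_high; rewrite up.
- exact: cvg_cst.
- apply: cvg_expr; rewrite ger0_norm ?invr_ge0 ?mulr_ge0 //.
  by rewrite invf_lt1 // (lt_trans ltr01).
Qed.

End StepPolynomials.

(** * Compactly supported charges are determined by their moments *)

Section WeightedLimits.
Variables (R : realType) (M : R).
Local Notation RT := (measurableTypeR R).
Implicit Types (mu : {measure set RT -> \bar R}) (f g : RT -> R) (q : {poly R}).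

Definition vanishes_off g := forall x, ~ `[-M, M]%classic x -> g x = 0.

Lemma poly_bounded_on q : exists C, forall x, `[-M, M]%classic x -> `|q.[x]| <= C.
Proof.
have /compact_bounded : compact (horner q @` `[-M, M]).
  apply: continuous_compact; last exact: segment_compact.
  by apply: continuous_subspaceT; exact: continuous_horner.
move=> [C [_ HC]]; exists (C + 1) => x Kx.
by apply: HC; [rewrite ltrDl|exists x].
Qed.

Lemma integrable_weighted mu f g C : vanishes_off g ->
  mu.-integrable setT (EFin \o g) -> measurable_fun setT f ->
  (forall x, `[-M, M]%classic x -> `|f x| <= C) ->
  mu.-integrable setT (EFin \o (fun x => f x * g x)).
Proof.
move=> g0 ig mf fC.
apply: (@le_integrable _ _ _ _ _ _ _ (EFin \o (fun x => C * g x))) => //.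
- apply/measurable_EFinP; apply: measurable_funM => //.
  by case/integrableP : ig => /measurable_EFinP.
- move=> x _; rewrite lee_fin /= !normrM.
  have [Kx|/g0 ->] := pselect (`[-M, M]%classic x); last by rewrite normr0 !mulr0.
  by rewrite ler_wpM2r // (le_trans (fC x Kx)) // ler_norm.
- exact: (integrableZl measurableT C ig).
Qed.

Lemma measurable_fun_horner q : measurable_fun setT (horner q : RT -> R).
Proof. by apply: continuous_measurable_fun; exact: continuous_horner. Qed.

Lemma integrable_poly_weighted mu q g : vanishes_off g ->
  mu.-integrable setT (EFin \o g) ->
  mu.-integrable setT (EFin \o (fun x => q.[x] * g x)).
Proof.
move=> g0 ig; have [C HC] := poly_bounded_on q.
apply: (@integrable_weighted _ (horner q) _ C) => //.
exact: measurable_fun_horner.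
Qed.

(** Dominated convergence: the step polynomials are bounded by 1 where [g] lives.
Stated with a weight, it applies both to Lebesgue measure with density [g] and
to the Jordan parts of a charge, with the indicator of their support. *)
Lemma step_poly_weighted mu a g : 0 < M -> vanishes_off g ->
  mu.-integrable setT (EFin \o g) ->
  (\int[mu]_x ((step_poly a (M + `|a|) n).[x] * g x))%R @[n --> \oo] -->
  (\int[mu]_x (\1_[set y | y < a] x * g x))%R.
Proof.
move=> M0 g0 ig.
have b0 : 0 < M + `|a| by rewrite ltr_pwDl.
have xab x : `[-M, M]%classic x -> `|x - a| <= M + `|a|.
  rewrite /= in_itv /= -ler_norml => xM.
  by rewrite (le_trans (ler_normB _ _)) // lerD2r.
have iS n := integrable_poly_weighted (step_poly a (M + `|a|) n) g0 ig.
have mA : measurable ([set y : RT | y < a]).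
  by rewrite -set_itvNyo; exact: measurable_itv.
have i1 : mu.-integrable setT (EFin \o (fun x => \1_[set y : RT| y < a] x * g x)).
  apply: (@integrable_weighted _ _ _ 1) => // x _.
  by rewrite ger0_norm // indicE; case: (_ \in _).
rewrite /Rintegral; apply: fine_cvg; rewrite fineK; last first.
  exact: integrable_fin_num.
have [] := @dominated_convergence _ RT R mu setT measurableT
  (fun n x => ((step_poly a (M + `|a|) n).[x] * g x)%:E)
  (fun x => (\1_[set y : RT| y < a] x * g x)%:E) (fun x => `|(g x)%:E|)%E => //.
- by move=> n; case/integrableP : (iS n).
- by case/integrableP : i1.
- apply: aeW => x _; have [Kx|/g0 ->] := pselect (`[-M, M]%classic x).
    apply: cvg_EFin; first by apply: nearW.
    by apply: cvgM; [apply: step_poly_cvg => //; exact: xab|exact: cvg_cst].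
  by rewrite mulr0; under eq_fun do rewrite mulr0; exact: cvg_cst.
- exact: integrable_abse.
- apply: aeW => x n _; rewrite /= lee_fin normrM.
  have [Kx|/g0 ->] := pselect (`[-M, M]%classic x); last by rewrite normr0 mulr0.
  by rewrite ler_piMl // step_poly_bound // xab.
Qed.

Lemma Rintegral_poly_weighted mu q g : vanishes_off g ->
  mu.-integrable setT (EFin \o g) ->
  (\int[mu]_x (q.[x] * g x) =
   \sum_(i < size q) q`_i * \int[mu]_x (x ^+ i * g x))%R.
Proof.
move=> g0 ig; rewrite -{1}(coefK q) poly_def.
have intX i : mu.-integrable setT (EFin \o (fun x => x ^+ i * g x)).
  have := integrable_poly_weighted 'X^i g0 ig.
  by under [X in EFin \o X]eq_fun do rewrite hornerXn.
elim: (index_enum _) => [|i s IH].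
  rewrite !big_nil /Rintegral; under eq_integral do rewrite horner0 mul0r.
  by rewrite integral0.
rewrite !big_cons -IH -RintegralZl // -RintegralD //.
- by apply: eq_Rintegral => x _; rewrite hornerD hornerZ hornerXn mulrDl mulrA.
- exact: (integrableZl measurableT _ (intX i)).
- exact: integrable_poly_weighted.
Qed.

Lemma vanishes_off_indic : vanishes_off \1_(`[-M, M]%classic).
Proof. by move=> x Kx; rewrite indicE memNset. Qed.

Lemma Rintegral_concentrated (mu : {finite_measure set RT -> \bar R}) q :
  mu (~` `[-M, M]%classic) = 0%E ->
  (\int[mu]_x q.[x] = \int[mu]_x (q.[x] * \1_(`[-M, M]%classic : set RT) x))%R.
Proof.
move=> mu0; have mK : measurable (`[-M, M]%classic : set RT) by exact: measurable_itv.
congr fine; apply: ae_eq_integral => //.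
- apply/measurable_EFinP; exact: measurable_fun_horner.
- apply/measurable_EFinP; apply: measurable_funM => //; exact: measurable_fun_horner.
exists (~` `[-M, M]%classic); split => //; first exact: measurableC.
move=> x; apply: contra_not => Kx _.
by rewrite indicE mem_set // mulr1.
Qed.

Lemma Rintegral_indic_concentrated (mu : {finite_measure set RT -> \bar R}) (A : set RT) :
  measurable A -> mu (~` `[-M, M]%classic) = 0%E ->
  (\int[mu]_x (\1_A x * \1_(`[-M, M]%classic : set RT) x))%R = fine (mu A).
Proof.
move=> mA mu0; have mK : measurable (`[-M, M]%classic : set RT) by exact: measurable_itv.
have mAK : measurable (A `&` `[-M, M]%classic) by exact: measurableI.
transitivity (\int[mu]_x \1_(A `&` `[-M, M]%classic) x)%R.
  by apply: eq_Rintegral => x _; rewrite indicI.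
rewrite /Rintegral integral_indic // setIT.
congr fine; rewrite (measureDI mu mA mK) [X in (X + _)%E](_ : _ = 0%E) ?add0e //.
by apply: (subset_measure0 _ _ _ mu0); [exact: measurableD|exact: measurableC|move=> x []].
Qed.

Lemma charge_integral_polyZ (nu : {charge set RT -> \bar R}) c q :
  (forall B : set RT, measurable B -> B `<=` ~` `[-M, M] -> nu B = 0%E) ->
  charge_integral nu setT (fun x => c * q.[x]) =
  c * charge_integral nu setT (horner q).
Proof.
move=> nu0; have mK : measurable (`[-M, M]%classic : set RT) by exact: measurable_itv.
have [P [N [hahn nuE]]] := charge_integralE nu.
have [p0 n0] := jordan_null hahn (measurableC mK) nu0.
have scale (mu : {finite_measure set RT -> \bar R}) : mu (~` `[-M, M]%classic) = 0%E ->
    (\int[mu]_x (c * q.[x]) = c * \int[mu]_x q.[x])%R.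
  move=> mu0; rewrite Rintegral_concentrated // -RintegralZl //; last first.
    apply: integrable_poly_weighted; first exact: vanishes_off_indic.
    exact: integrable_indic.
  under eq_Rintegral do rewrite -hornerZ.
  rewrite Rintegral_concentrated //.
  by apply: eq_Rintegral => x _; rewrite hornerZ mulrA.
by rewrite !nuE !scale // mulrBr.
Qed.

(** Equal moments give equal integrals of all polynomials, hence in the limit equal
masses of all open left half-lines. *)
Theorem charge_of_moments (nu : {charge set RT -> \bar R}) g
    (ig : (@lebesgue_measure R).-integrable setT (EFin \o g)) :
  0 < M -> (forall B : set RT, measurable B -> B `<=` ~` `[-M, M] -> nu B = 0%E) ->
  vanishes_off g ->
  (forall k, charge_integral nu setT (fun x => x ^+ k) =
     \int[@lebesgue_measure R]_x (x ^+ k * g x))%R ->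
  forall A, measurable A ->
  nu A = (\int[@lebesgue_measure R]_(x in A) (g x)%:E)%E.
Proof.
move=> M0 nu0 g0 nug.
have mK : measurable (`[-M, M]%classic : set RT) by exact: measurable_itv.
have [P [N [hahn nuE]]] := charge_integralE nu.
have [p0 n0] := jordan_null hahn (measurableC mK) nu0.
have iK (mu : {finite_measure set RT -> \bar R}) :
  mu.-integrable setT (EFin \o (\1_(`[-M, M]%classic : set RT) : RT -> R)).
  exact: integrable_indic.
pose w : RT -> R := \1_(`[-M, M]%classic : set RT).
have polyE q : (\int[jordan_pos hahn]_x (q.[x] * w x) -
    \int[jordan_neg hahn]_x (q.[x] * w x) =
    \int[@lebesgue_measure R]_x (q.[x] * g x))%R.
  have w0 := vanishes_off_indic.
  rewrite (Rintegral_poly_weighted q w0 (iK (jordan_pos hahn))).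
  rewrite (Rintegral_poly_weighted q w0 (iK (jordan_neg hahn))).
  rewrite (Rintegral_poly_weighted q g0 ig) -sumrB.
  apply: eq_bigr => k _; rewrite -mulrBr -nug nuE.
  have XE (mu : {finite_measure set RT -> \bar R}) :
      mu (~` `[-M, M]%classic) = 0%E ->
      (\int[mu]_x (x ^+ k) = \int[mu]_x (x ^+ k * w x))%R.
    move=> /(Rintegral_concentrated 'X^k).
    under eq_Rintegral do rewrite hornerXn.
    by under [in X in _ = X -> _]eq_Rintegral do rewrite hornerXn.
  by rewrite !XE.
have nuA A : measurable A -> nu A =
    ((\int[jordan_pos hahn]_x (\1_A x * w x))%R -
     (\int[jordan_neg hahn]_x (\1_A x * w x))%R)%:E.
  move=> mA; rewrite !Rintegral_indic_concentrated // -fineB ?fin_num_measure //.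
  rewrite fineK; last by rewrite fin_numB !fin_num_measure.
  by rewrite (jordan_decomp hahn mA) /cadd /= cscaleN1.
have gA A : measurable A -> (\int[@lebesgue_measure R]_(x in A) (g x)%:E)%E =
    (\int[@lebesgue_measure R]_x (\1_A x * g x))%R%:E.
  move=> mA; rewrite -[LHS]fineK.
    congr EFin; rewrite -/(Rintegral _ A g) Rintegral_mkcond.
    apply: eq_Rintegral => x _; rewrite patchE indicE.
    by case: (x \in A); rewrite ?mul1r ?mul0r.
  apply: integrable_fin_num => //; exact: integrableS ig.
move=> A mA.
apply: (@charge_eq_pi_system _ _ _ nu (induced_charge ig) (@RGenInftyO.G R)) => //.
- move=> B mB.
  by have : (@RGenInftyO.G R).-sigma.-measurable B by rewrite -RGenInftyO.measurableE.
- by move=> _ [x ->]; exact: measurable_itv.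
- move=> _ _ [x ->] [y ->]; exists (Num.min x y).
  by apply/seteqP; split => z /=; rewrite !in_itv /= lt_min => /andP.
- rewrite [RHS]gA // nuA //; congr EFin.
  have -> : (\1_[set: RT] : RT -> R) = horner 1.
    by apply/funext => x; rewrite indicE in_setT hornerC.
  exact: polyE.
- move=> _ [a ->].
  have -> : `]-oo, a[%classic = [set y : RT | y < a].
    by apply/seteqP; split => z /=; rewrite in_itv.
  have ma : measurable [set y : RT | y < a].
    by rewrite -set_itvNyo; exact: measurable_itv.
  rewrite [RHS]gA // nuA //; congr EFin.
  have cp := step_poly_weighted (a := a) M0 vanishes_off_indic (iK (jordan_pos hahn)).
  have cn := step_poly_weighted (a := a) M0 vanishes_off_indic (iK (jordan_neg hahn)).
  have cg := step_poly_weighted (a := a) M0 g0 ig.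
  have cd := cvgB cp cn.
    (* By linearity the two sequences of integrals coincide term by term. *)
have cdE : (fun n => (\int[jordan_pos hahn]_x ((step_poly a (M + `|a|) n).[x] * w x))%R -
      (\int[jordan_neg hahn]_x ((step_poly a (M + `|a|) n).[x] * w x))%R) =
    (fun n => \int[@lebesgue_measure R]_x ((step_poly a (M + `|a|) n).[x] * g x))%R.
    by apply/funext => n; exact: polyE.
  have {}cd : (fun n => \int[@lebesgue_measure R]_x ((step_poly a (M + `|a|) n).[x] * g x))%R
      @ \oo --> ((\int[jordan_pos hahn]_x (\1_[set y | y < a] x * w x))%R -
      (\int[jordan_neg hahn]_x (\1_[set y | y < a] x * w x))%R).
    by rewrite -cdE; exact: cd.
  by rewrite -(cvg_lim (@Rhausdorff R) cd) -(cvg_lim (@Rhausdorff R) cg).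
Qed.

End WeightedLimits.

(** * The noncommutative measure is carried by words of eigenvalues *)

Section Boxes.
Context d (T : measurableType d) (k : nat).

Definition box (A : 'I_k -> set T) : set (k.-tuple T) :=
  [set x | forall i, A i (tnth x i)].

Definition boxes : set (set (k.-tuple T)) :=
  [set B | exists2 A : 'I_k -> set T, (forall i, measurable (A i)) & B = box A].

Lemma measurable_box A : (forall i, measurable (A i)) -> measurable (box A).
Proof.
move=> mA; have -> : box A = \bigcap_(i in [set: 'I_k]) ((fun x => tnth x i) @^-1` A i).
  by apply/seteqP; split => x /= xA i; [move=> _; exact: xA|exact: (xA i I)].
apply: fin_bigcap_measurable => // i _.
by rewrite -[X in measurable X]setTI; exact: measurable_tnth.
Qed.

Lemma setI_closed_boxes : setI_closed boxes.
Proof.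
move=> _ _ [A mA ->] [B mB ->]; exists (fun i => A i `&` B i).
  by move=> i; exact: measurableI.
apply/seteqP; split => x /=; first by move=> [xA xB] i; split.
by move=> xAB; split => i; have [] := xAB i.
Qed.

Lemma boxes_generate : measurable `<=` <<s boxes >>.
Proof.
apply: smallest_sub; first exact: smallest_sigma_algebra.
apply: (big_ind (fun X => X `<=` <<s boxes >>)) => //.
- by move=> X Y sX sY B [/sX|/sY].
move=> i _ _ [A mA <-]; apply: sub_sigma_algebra.
exists (fun j => if j == i then A else setT); first by move=> j; case: ifP.
apply/seteqP; split => x /=.
  by move=> [_ Ax] j; case: eqP => // ->.
by move=> /(_ i); rewrite eqxx.
Qed.

Lemma measurable_tuple1 (x : k.-tuple T) :
  (forall i, measurable [set tnth x i]) -> measurable [set x].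
Proof.
move=> mx; have -> : [set x] = box (fun i => [set tnth x i]).
  apply/seteqP; split => y /=; first by move=> ->.
  by move=> yx; exact: eq_from_tnth.
exact: measurable_box.
Qed.

End Boxes.

Section WordLists.
Variable R : realType.
Implicit Types S : seq R.

Lemma mem_words S p (w : p.+1.-tuple R) : (w \in words S p) = all (mem S) w.
Proof.
elim: p w => [|p IH] w.
  case/tupleP: w => z w; rewrite [w]tuple0 /= andbT.
  apply/mapP/idP => [[y yS /(congr1 val) [->]] //|zS].
  by exists z => //; apply/val_inj.
case/tupleP: w => z w /=; rewrite -IH.
apply/allpairsPdep/andP => [[v [y [vw yS /(congr1 val) /= [-> /val_inj ->]]]] //|[zS wS]].
by exists w, z; split.
Qed.

Lemma uniq_words S p : uniq S -> uniq (words S p).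
Proof.
move=> uS; elim: p => [|p IH] /=.
  by rewrite map_inj_uniq // => x y /(congr1 val) [].
apply: allpairs_uniq => // -[w z] [v y] _ _ /= /(congr1 val) /= [-> /val_inj ->] //.
Qed.

End WordLists.

Section SpectralMeasureSupport.
Variables (R : realType) (n p : nat) (H0 V : 'M[R[i]]_n) (S : seq R).
Local Notation RT := (measurableTypeR R).
Hypotheses (uS : uniq S).
Hypotheses (S0 : {subset spectrum H0 <= S}) (S1 : {subset spectrum (H0 + V) <= S}).
Variable m : complex_measure (p.+1.-tuple RT) R.
Hypothesis hm : is_m2 H0 V m.

Definition nodes : seq (p.+1.-tuple RT) := [seq rev_tuple w | w <- words S p].

Lemma uniq_nodes : uniq nodes.
Proof.
rewrite map_inj_uniq ?uniq_words // => w v /(congr1 val) /= /(congr1 rev).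
by rewrite !revK => /val_inj.
Qed.

Lemma mem_nodes (x : p.+1.-tuple RT) : (x \in nodes) = all (mem S) x.
Proof.
apply/mapP/idP => [[w]|xS]; first by rewrite mem_words => wS ->; rewrite all_rev.
exists (rev_tuple x); last by apply/val_inj; rewrite /= revK.
by rewrite mem_words all_rev.
Qed.

Lemma nodes_box : [set` nodes] = box (fun=> [set` S] : set RT).
Proof.
apply/seteqP; split => x /=; rewrite mem_nodes.
  by move=> /all_tnthP xS i; exact: xS.
by move=> xS; apply/all_tnthP => i; exact: xS.
Qed.

Lemma measurable_nodes1 (x : p.+1.-tuple RT) : measurable [set x].
Proof. by apply: measurable_tuple1 => i; exact: measurable_set1. Qed.

Lemma measurable_nodes : measurable [set` nodes].
Proof. by apply: measurable_support => x _; exact: measurable_nodes1. Qed.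

(** Spectral projections ignore whatever lies off the spectrum. *)
Lemma cmeasure_box_nodes (A : 'I_p.+1 -> set RT) : (forall i, measurable (A i)) ->
  cmeasure m (box A) = cmeasure m (box A `&` [set` nodes]).
Proof.
move=> mA; have mS : measurable ([set` S] : set RT).
  by apply: measurable_support => x _; exact: measurable_set1.
have -> : box A `&` [set` nodes] = box (fun i => A i `&` [set` S]).
  rewrite nodes_box; apply/seteqP; split => x /=; first by move=> [xA xB] i; split.
  by move=> xAB; split => i; have [] := xAB i.
rewrite [LHS]hm // [RHS]hm; last by move=> i; exact: measurableI.
rewrite -(spectral_measure_restr _ S1).
by under [in RHS]eq_bigr do rewrite -(spectral_measure_restr _ S0).
Qed.

(** The restriction to [nodes] is another charge with the same values on boxes. *)
Lemma nodes_concentrated (B : set (p.+1.-tuple RT)) : measurable B ->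
  B `<=` ~` [set` nodes] -> cmRe m B = 0%E /\ cmIm m B = 0%E.
Proof.
move=> mB /disjoints_subset B0.
have mN := measurable_nodes.
have boxE A : boxes A ->
    cmRe m A = crestr (cmRe m) mN A /\ cmIm m A = crestr (cmIm m) mN A.
  move=> [C mC ->]; have mbox := measurable_box mC.
  have mboxN : measurable (box C `&` [set` nodes]) by exact: measurableI.
  have [eRe eIm] := cmeasure_box_nodes mC.
  rewrite /crestr -[LHS]fineK ?fin_num_measure // eRe fineK ?fin_num_measure //.
  split => //.
  by rewrite -[LHS]fineK ?fin_num_measure // eIm fineK ?fin_num_measure.
have setTbox : boxes [set: p.+1.-tuple RT].
  by exists (fun=> setT) => //; apply/seteqP; split.
have bm : @boxes _ RT p.+1 `<=` measurable.
  by move=> _ [A mA ->]; exact: measurable_box.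
have restr (nu : {charge set (p.+1.-tuple RT) -> \bar R}) :
    (forall A, boxes A -> nu A = crestr nu mN A) -> nu B = 0%E.
  move=> nuE; suff -> : nu B = crestr nu mN B by rewrite /crestr B0 charge0.
  apply: (charge_eq_pi_system (@boxes_generate _ RT p.+1) bm (@setI_closed_boxes _ RT p.+1)) => //.
  exact: nuE.
by split; apply: restr => A /boxE [].
Qed.

Lemma cmeasure_node (w : p.+1.-tuple R) :
  cmeasure m [set (rev_tuple w : p.+1.-tuple RT)] = \tr (mxword H0 V w).
Proof.
have -> : [set (rev_tuple w : p.+1.-tuple RT)] =
    [set x : p.+1.-tuple RT | forall i : 'I_p.+1, [set (nth 0 (rev w) i : RT)] (tnth x i)].
  apply/seteqP; split => x /=.
    by move=> -> i; rewrite (tnth_nth 0).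
  by move=> xw; apply: eq_from_tnth => i; rewrite xw (tnth_nth 0).
rewrite (hm (A := fun i : 'I_p.+1 => [set (nth 0 (rev w) i : RT)])); last first.
  by move=> i; exact: measurable_set1.
by rewrite -(mxword_prod H0 V (p := p)) // size_tuple.
Qed.

Lemma cmeasure_integral_nodes D (f : p.+1.-tuple RT -> R) :
  cmeasure_integral m D f =
  \sum_(w <- words S p) ((f \_ D) (rev_tuple w))%:C * \tr (mxword H0 V w).
Proof.
rewrite /cmeasure_integral.
rewrite !(charge_integral_finite_support uniq_nodes (fun x _ => measurable_nodes1 x));
  [|by move=> B mB /(nodes_concentrated mB) []..].
rewrite !big_map.
apply/eqP; rewrite eq_complex /= Re_sum Im_sum; apply/andP; split; apply/eqP;
  apply: eq_bigr => w _; by rewrite ?Re_real_mul ?Im_real_mul -cmeasure_node.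
Qed.

End SpectralMeasureSupport.

(** * The density and its moments *)

Section NodeTuples.
Variable R : realType.

Lemma divdiff_rev_tuple p (z : R) (s : p.-tuple R) f :
  divdiff (rev_tuple (cons_tuple z s)) f = divdiff_rev f s z.
Proof.
set l := rev_tuple _; have lE : thead l :: behead l = rcons (rev s) z.
  by rewrite -rev_cons -[RHS]/(tval l) {3}(tuple_eta l).
rewrite /divdiff; move: lE; rewrite lastI => /rcons_inj [-> ->].
by rewrite revK.
Qed.

Lemma diagonal_nseq p (w : p.+1.-tuple R) :
  @Defs.diagonal R p.+1 (rev_tuple w) ->
  exists z, tval w = nseq p.+1 z.
Proof.
move=> dw; exists (thead w); rewrite -[X in nseq X](size_tuple w).
apply/all_pred1P/allP => x /=; rewrite -mem_rev => /tnthP -[i ->].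
have : thead w \in rev w by rewrite mem_rev mem_tnth.
by move=> /tnthP [j ->]; apply/eqP; exact: dw.
Qed.

Lemma nondiagonal_count p (w : p.+1.-tuple R) z :
  ~ @Defs.diagonal R p.+1 (rev_tuple w) ->
  (count_mem z w <= p)%N.
Proof.
move=> dw; rewrite leqNgt; apply: contra_notN dw => cw i j.
have : all (pred1 z) w.
  rewrite all_count eqn_leq count_size size_tuple; exact: cw.
rewrite -all_rev => /all_tnthP wz.
by rewrite (eqP (wz i)) (eqP (wz j)).
Qed.

End NodeTuples.

Section Density.
Variables (R : realType) (n k : nat) (H0 V : 'M[R[i]]_n).
Hypotheses (hH0 : H0 \is hermsymmx) (hV : V \is hermsymmx).
Variables (S : seq R) (idem : R -> {poly R}) (a : R).
Hypotheses (uS : uniq S) (S0 : {subset spectrum H0 <= S})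
  (S1 : {subset spectrum (H0 + V) <= S}).
Hypothesis idem1 : forall z, z \in S -> ('X - z%:P) ^+ k.+2 %| idem z - 1.
Hypothesis idem0 : forall z y, z \in S -> y \in S -> y != z ->
  ('X - y%:P) ^+ k.+2 %| idem z.
Hypothesis aS : forall z, z \in S -> a < z.
Local Notation RT := (measurableTypeR R).
Local Notation leb := (@lebesgue_measure R).

Let weight (w : seq R) : R[i] := \tr (mxword H0 V w).

(** With [theta = 0] and [theta = 1] this gives the real part, and the sum of the
real and imaginary parts; treating both at once yields two densities of the same
charge, hence a vanishing imaginary part. *)
Definition re_im_comb (theta : R) (c : R[i]) : R := complex.Re c + theta * complex.Im c.

Lemma re_im_comb_sum theta (I : Type) (r : seq I) (F : I -> R[i]) :
  re_im_comb theta (\sum_(i <- r) F i) = \sum_(i <- r) re_im_comb theta (F i).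
Proof. by rewrite /re_im_comb Re_sum Im_sum mulr_sumr -big_split. Qed.

Lemma re_im_comb_real_mul theta x c : re_im_comb theta (x%:C * c) = x * re_im_comb theta c.
Proof. by rewrite /re_im_comb Re_real_mul Im_real_mul mulrDr mulrCA. Qed.

Definition density_poly theta z : {poly R} :=
  \sum_(w <- words S k.+1) ((k`!)%:R^-1 * re_im_comb theta (weight w)) *:
     kernel_poly w k (idem z).

Definition density theta : R -> R := piecewise_poly a S (density_poly theta).

Lemma weight_diagonal (w : k.+2.-tuple R) :
  @Defs.diagonal R k.+2 (rev_tuple w) -> weight w = 0.
Proof.
move=> /diagonal_nseq [z ->]; rewrite /weight (mxword_diag z k hH0 (hermsymmxD hH0 hV)).
exact: mxtrace0.
Qed.

Lemma nderivn_derivn (f : {poly R}) :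
  f^`N(k.+1) *+ k.+1 = (k`!)%:R^-1 *: f^`(k.+1).
Proof.
rewrite nderivn_def factS mulrnA -scalerMnr scalerMnl -mulr_natr.
by rewrite mulVf ?scale1r // pnatr_eq0 -lt0n fact_gt0.
Qed.

(** Peano's theorem, summed over the words with their weights; constant words drop
out because their weight is zero. *)
Lemma Rintegral_density theta j :
  (((j + k.+1) ^_ k.+1)%:R *
   \int[leb]_x (x ^+ j * density theta x))%R =
  re_im_comb theta (\sum_(w <- words S k.+1) (ddiff 'X^(j + k.+1) w)%:C * weight w).
Proof.
set f : {poly R} := 'X^(j + k.+1).
set D : R := _%:R.
have D0 : D != 0 by rewrite pnatr_eq0 -lt0n ffact_gt0 leq_addl.
have dprim (w : seq R) (e : {poly R}) :
    (kernel_primitive w k.+1 f e)^`() = (D / (k`!)%:R) *: ('X^j * kernel_poly w k e).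
  rewrite deriv_kernel_primitive nderivn_derivn /f derivnXn addnK.
  by rewrite -scalerAl mulrnAl -scalerMnr scalerMnl -mulr_natl.
(* The normalization turns the [(k+1)]-st derivative of [f] into [X^j]. *)
pose P z := \sum_(w <- words S k.+1) (re_im_comb theta (weight w) / D) *:
  kernel_primitive w k.+1 f (idem z).
transitivity (D * \int[leb]_x (piecewise_poly a S (fun z => 'X^j * density_poly theta z) x))%R.
  congr (_ * _); apply: eq_Rintegral => x _.
  by rewrite -piecewise_polyM hornerXn.
rewrite (@Rintegral_piecewise_poly _ a S _ P); last first.
  move=> z zS; split; first exact: aS.
  rewrite /P raddf_sum /density_poly mulr_sumr; apply: eq_bigr => w _.
  rewrite /= derivZ dprim scalerA -[RHS]scalerAr; congr (_ *: _).
  by rewrite mulrA divfK // mulrC.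
have PE z x : (P z).[x] = \sum_(w <- words S k.+1) (re_im_comb theta (weight w) / D) *
    (kernel_primitive w k.+1 f (idem z)).[x].
  by rewrite /P horner_sum; apply: eq_bigr => w _; rewrite hornerZ.
under eq_bigr => z _ do rewrite !PE -sumrB.
rewrite exchange_big mulr_sumr re_im_comb_sum big_seq [RHS]big_seq.
apply: eq_bigr => w wS; rewrite re_im_comb_real_mul.
under eq_bigr => z _ do rewrite -mulrBr.
rewrite -mulr_sumr.
have [/weight_diagonal ->|dw] := pselect (@Defs.diagonal R k.+2 (rev_tuple w)).
  by rewrite /re_im_comb /= mulr0 addr0 !mul0r !mulr0.
rewrite (peano_identity uS idem1 idem0) ?size_tuple //.
- by rewrite mulrA mulrCA divff // mulr1 mulrC.
- by move=> z; move: wS; rewrite mem_words => /allP; exact.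
- by move=> z; exact: nondiagonal_count.
Qed.

(** Left of [a] all conditions [t < z] hold, the idempotents sum up to 1, and the
divided difference of [(X - t)^k] has order exceeding the degree: the kernel
vanishes there like the piecewise polynomial. *)
Lemma truncpow_kernel (w : k.+2.-tuple R) t : w \in words S k.+1 -> t \notin S ->
  divdiff (rev_tuple w) (fun x => truncpow k (x - t)) =
  piecewise_poly a S (fun z => kernel_poly w k (idem z)) t.
Proof.
rewrite mem_words => wS tS; have sS : {subset w <= S} by apply/allP.
case/tupleP: w wS sS => z s wS sS.
have ss : size s = k.+1 by rewrite size_tuple.
rewrite divdiff_rev_tuple (@divdiff_truncpow _ S k idem) ?ss //.
rewrite /piecewise_poly; have [at_|ta] := leP a t.
  rewrite big_seq [RHS]big_seq; apply: eq_bigr => y yS; rewrite patchE.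
  have -> : (t \in `[a, y]%classic) = (t < y).
    rewrite mem_setE in_itv /= at_ /= le_eqVlt; case: eqP => // ty.
    by rewrite ty yS in tS.
  by [].
rewrite [RHS]big1; last first.
  move=> y _; rewrite patchE memNset //= in_itv /= => /andP[].
  by rewrite leNgt ta.
transitivity (\sum_(y <- S) ddiff (('X - t%:P) ^+ k * idem y) (z :: s)).
  rewrite big_seq [RHS]big_seq; apply: eq_bigr => y yS.
  by rewrite (lt_trans ta (aS yS)) horner_kernel_poly.
rewrite -ddiff_sum -mulr_sumr (ddiff_sum_idem uS idem1 idem0) //; last by rewrite /= ss.
by rewrite ddiff_small // size_exp_XsubC ss.
Qed.

Lemma eta_density (m : complex_measure (k.+2.-tuple RT) R) t :
  is_m2 H0 V m -> t \notin S ->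
  complex.Re (eta m t) = density 0 t /\ complex.Im (eta m t) = density 1 t - density 0 t.
Proof.
move=> hm tS.
pose psi (w : k.+2.-tuple R) := piecewise_poly a S (fun z => kernel_poly w k (idem z)) t.
have etaE : eta m t = \sum_(w <- words S k.+1) ((k`!)%:R^-1 * psi w)%:C * weight w.
  rewrite /eta /= (cmeasure_integral_nodes uS S0 S1 hm) mulr_sumr.
  rewrite big_seq [RHS]big_seq; apply: eq_bigr => w wS.
  rewrite rmorphM /= fmorphV rmorph_nat -mulrA; congr (_ * _).
  rewrite -/(weight w); have [dw|dw] := pselect (@Defs.diagonal R k.+2 (rev_tuple w)).
    by rewrite weight_diagonal // !mulr0.
  by rewrite patchE mem_set //= truncpow_kernel.
have densE theta : density theta t = re_im_comb theta (eta m t).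
  rewrite etaE re_im_comb_sum /density /piecewise_poly.
  under [RHS]eq_bigr => w _ do rewrite re_im_comb_real_mul /psi /piecewise_poly mulr_sumr mulr_suml.
  rewrite [RHS]exchange_big; apply: eq_bigr => z _.
  rewrite patchE; case: ifP => tz.
    rewrite /density_poly horner_sum; apply: eq_bigr => w _.
    by rewrite patchE tz hornerZ mulrAC.
  by rewrite big1 // => w _; rewrite patchE tz mulr0 mul0r.
by rewrite !densE /re_im_comb !mul0r mul1r !addr0 addrAC subrr add0r.
Qed.

(** The trace formula for the monomial of degree [j + p]: its [p]-th derivative is
a multiple of [t^j], and its left-hand side is real. *)
Lemma trace_formula_moments (nu : {charge set RT -> \bar R}) M theta j :
  (forall B : set RT, measurable B -> B `<=` ~` `[-M, M] -> nu B = 0%E) ->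
  trace_formula_measure k.+1 H0 V nu ->
  (charge_integral nu setT (fun x => x ^+ j) =
   \int[leb]_x (x ^+ j * density theta x))%R.
Proof.
move=> nu0 [_ nuf].
set D : R := ((j + k.+1) ^_ k.+1)%:R.
have D0 : D != 0 by rewrite pnatr_eq0 -lt0n ffact_gt0 leq_addl.
apply: (mulfI D0); rewrite Rintegral_density.
have rat : rational_nonreal_poles (fun x : R => (x ^+ (j + k.+1))%:C).
  exists 'X^(j + k.+1), 1; split=> x; first by rewrite hornerC oner_eq0.
  by rewrite hornerC divr1 hornerXn rmorphXn.
have := nuf _ rat; rewrite remainder_monomial //.
rewrite (taylor_tail_words _ _ uS hH0 (hermsymmxD hH0 hV) S0 S1).
rewrite linear_sum /=; under eq_bigr => w _ do rewrite linearZ /=.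
move=> ->.
have -> : cderiven k.+1 (fun x : R => (x ^+ (j + k.+1))%:C) =
    (fun t => (D * ('X^j).[t])%:C).
  apply/funext => t; rewrite /cderiven.
  have -> : (fun s : R => complex.Re (s ^+ (j + k.+1))%:C) = horner 'X^(j + k.+1).
    by apply/funext => s; rewrite hornerXn.
  have -> : (fun s : R => complex.Im (s ^+ (j + k.+1))%:C) = horner (0 : {poly R}).
    by apply/funext => s; rewrite horner0.
  rewrite !derive1n_horner derivnXn addnK raddf0 horner0 hornerMn mulr_natl.
  by [].
rewrite /charge_cintegral /re_im_comb /= (charge_integral_polyZ _ _ nu0).
have -> : charge_integral nu setT (fun=> 0 : R) = 0.
  have [P [N [hahn ->]]] := charge_integralE nu.
  by rewrite /Rintegral !integral0 subrr.
rewrite mulr0 addr0; congr (_ * charge_integral _ _ _).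
by apply/funext => x; rewrite hornerXn.
Qed.

End Density.

(** * The density of the trace formula *)

Lemma compact_bound (R : realType) (K : set R) (S : seq R) : compact K ->
  exists M, [/\ 0 < M, K `<=` `[-M, M]%classic & forall z, z \in S -> - M < z < M].
Proof.
move=> /compact_bounded [C [_ HC]].
have [B HB] : exists B, forall z, z \in S -> `|z| <= B.
  elim: S => [|y S [B HB]]; first by exists 0.
  exists (Num.max `|y| B) => z; rewrite inE le_max => /orP[/eqP ->|/HB ->].
    by rewrite lexx.
  by rewrite orbT.
pose M := Num.max (`|C| + 1) (`|B| + 1).
have M1 : `|C| + 1 <= M by rewrite le_max lexx.
have M2 : `|B| + 1 <= M by rewrite le_max lexx orbT.
exists M; split.
- by rewrite (lt_le_trans _ M1) // ltr_wpDl.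
- move=> x Kx; rewrite /= in_itv /= -ler_norml.
  apply: le_trans M1; apply: HC => //.
  by rewrite (le_lt_trans (ler_norm C)) // ltrDl.
- move=> z /HB zB; rewrite -ltr_norml; apply: lt_le_trans M2.
  by rewrite (le_lt_trans zB) // (le_lt_trans (ler_norm B)) // ltrDl.
Qed.

Theorem corollary9p4 (R : realType) (n p : nat) (hp : (0 < p)%N)
    (H0 V : 'M[R[i]]_n) (hH0 : H0 \is hermsymmx) (hV : V \is hermsymmx)
    (nu : {charge set (measurableTypeR R) -> \bar R})
    (hnu : trace_formula_measure p H0 V nu)
    (m : complex_measure (p.+1.-tuple (measurableTypeR R)) R)
    (hm : is_m2 H0 V m) :
  nu `<< @lebesgue_measure R /\
  {ae @lebesgue_measure R, forall t : R,
     ('d nu '/d (@lebesgue_measure R)) t = (complex.Re (eta m t))%:E /\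
     complex.Im (eta m t) = 0}.
Proof.
case: p hp hnu m hm => // k _ hnu m hm.
pose S := undup (spectrum H0 ++ spectrum (H0 + V)).
have uS : uniq S by exact: undup_uniq.
have S0 : {subset spectrum H0 <= S} by move=> z zS; rewrite mem_undup mem_cat zS.
have S1 : {subset spectrum (H0 + V) <= S}.
  by move=> z zS; rewrite mem_undup mem_cat zS orbT.
have /boolp.choice [idem idemP] z : exists e : {poly R}, z \in S ->
    ('X - z%:P) ^+ k.+2 %| e - 1 /\
    forall y, y \in S -> y != z -> ('X - y%:P) ^+ k.+2 %| e.
  have [zS|zS] := boolP (z \in S); last by exists 0.
  by have [e He] := idempotent_exists k.+2 uS zS; exists e.
have idem1 z : z \in S -> ('X - z%:P) ^+ k.+2 %| idem z - 1.
  by move=> /idemP [].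
have idem0 z y : z \in S -> y \in S -> y != z -> ('X - y%:P) ^+ k.+2 %| idem z.
  by move=> /idemP [_]; exact.
have [[K [cK nuK]] _] := hnu.
have [M [M0 KM SM]] := compact_bound S cK.
have nu0 (B : set (measurableTypeR R)) :
    measurable B -> B `<=` ~` `[-M, M] -> nu B = 0%E.
  move=> mB BM; apply: nuK => //; apply/disjoints_subset.
  by apply: subset_trans BM _; exact: subsetC.
have aS z : z \in S -> - M < z by move=> /SM /andP[].
pose g := density k H0 V S idem (- M).
have ig theta := integrable_piecewise_poly (- M) S (density_poly k H0 V S idem theta).
have goff theta : vanishes_off M (g theta).
  move=> x; apply: piecewise_poly_out => z zS; rewrite in_itv /=.
  by have /andP[/ltW -> /ltW ->] := SM z zS.
have nuE theta A : measurable A ->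
    nu A = (\int[@lebesgue_measure R]_(x in A) (g theta x)%:E)%E.
  apply: (charge_of_moments (ig theta) M0 nu0 (goff theta)) => j.
  exact: (trace_formula_moments hH0 hV uS S0 S1 idem1 idem0 aS _ _ nu0 hnu).
have mg theta : measurable_fun setT (EFin \o g theta).
  by case/integrableP : (ig theta).
have nuac : nu `<< @lebesgue_measure R.
  apply/null_content_dominatesP => A mA A0; rewrite (nuE 0) //.
  by apply: null_set_integral => //; apply: measurable_funTS; exact: mg.
split => //.
have aeS : {ae @lebesgue_measure R, forall t : R, t \notin S}.
  exists [set` S]; split.
  - by apply: measurable_support => x _; exact: measurable_set1.
  - exact: countable_lebesgue_measure0 (finite_set_countable (finite_seq S)).
  by move=> t /= /negP; rewrite negbK.
have aeRN : {ae @lebesgue_measure R, forall t : R,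
    ('d nu '/d (@lebesgue_measure R)) t = (g 0 t)%:E}.
  have := @integral_ae_eq _ _ _ (@lebesgue_measure R) setT measurableT
    (EFin \o g 0) ('d nu '/d (@lebesgue_measure R)) (Radon_Nikodym_integrable nuac) (mg 0).
  have step (E : set (measurableTypeR R)) : E `<=` setT -> measurable E ->
     (\int[@lebesgue_measure R]_(x in E) ('d nu '/d (@lebesgue_measure R)) x =
     \int[@lebesgue_measure R]_(x in E) (g 0 x)%:E)%E.
    by move=> _ mE; rewrite -Radon_Nikodym_integral // (nuE 0).
  by move=> /(_ step); apply: filterS => t; exact.
have aeIm : {ae @lebesgue_measure R, forall t : R, g 0 t = g 1 t}.
  have := @integral_ae_eq _ _ _ (@lebesgue_measure R) setT measurableT
    (EFin \o g 1) (EFin \o g 0) (ig 0) (mg 1).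
  have step (E : set (measurableTypeR R)) : E `<=` setT -> measurable E ->
     (\int[@lebesgue_measure R]_(x in E) (g 0 x)%:E =
     \int[@lebesgue_measure R]_(x in E) (g 1 x)%:E)%E.
    by move=> _ mE; rewrite -!nuE.
  by move=> /(_ step); apply: filterS => t /(_ I) [].
have aeF := ae_filter_ringOfSetsType (@lebesgue_measure R).
move: aeS aeRN aeIm; apply: filterS3 => t tS -> gt.
have [-> ->] := eta_density hH0 hV uS S0 S1 idem1 idem0 aS hm tS.
by rewrite -/(g 0 t) -/(g 1 t) gt subrr.
Qed.
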